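(* Let $\mathbb{V}$ be a game mapping that satisfies the dynamic programming principle on $\mathfrak{D}$, let $\mathcal{V}[\varrho]:=\mathbb{V}\big[c[\varrho]\big]$ for $\varrho\in\mathfrak{D}$, and let $U_*:\Omega\to[0,1]$ be an arbitrary function. Then the following conditions are equivalent: (c) for every density $\mu\in\mathfrak{D}$ that is piecewise continuous on $(0,\infty)$, $\lim_{\lambda\to+0}\sup_{\omega\in\Omega}\big|\mathcal{V}[\mu^\lambda_{\mathrm{scale}}](\omega)-U_*(\omega)\big|=0$; (u) $\lim_{T\to+\infty}\sup_{\omega\in\Omega}\big|\mathcal{V}[\varpi_T](\omega)-U_*(\omega)\big|=0$; (e) $\lim_{\lambda\to+0}\sup_{\omega\in\Omega}\big|\mathcal{V}[\pi_\lambda](\omega)-U_*(\omega)\big|=0$; (p) for some power density $\varrho\in\mathfrak{D}$, $\lim_{T\to+\infty}\sup_{\omega\in\Omega}\big|\mathcal{V}[\varrho^T_{\mathrm{shift}}](\omega)-U_*(\omega)\big|=0$; (q) for every power density $\varrho\in\mathfrak{D}$, $\lim_{T\to+\infty}\sup_{\omega\in\Omega}\big|\mathcal{V}[\varrho^T_{\mathrm{shift}}](\omega)-U_*(\omega)\big|=0$. In particular, if for some density $\mu\in\mathfrak{D}$ piecewise continuous on $(0,\infty)$ and some power density $\varrho\in\mathfrak{D}$ at least one of the first three limits among $\lim_{T\to+\infty}\mathcal{V}[\varpi_T]$, $\lim_{\lambda\to+0}\mathcal{V}[\pi_\lambda]$, $\lim_{T\to+\infty}\mathcal{V}[\varrho^T_{\mathrm{shift}}]$,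 $\lim_{\lambda\to+0}\mathcal{V}[\mu^\lambda_{\mathrm{scale}}]$ exists and is uniform on $\Omega$, then all four of these limits exist, are uniform on $\Omega$, coincide, and do not depend on the choice of such $\mu$ and $\varrho$.
   Context: $\mathbb{R}_+=[0,\infty)$. Fix a nonempty set $\Omega$, a nonempty set $\mathbb{K}$ of maps $\mathbb{R}_+\to\Omega$, and a map $g:\Omega\to[0,1]$ such that $t\mapsto g(z(t))$ is Lebesgue measurable for every $z\in\mathbb{K}$. Let $\mathfrak{C}$ be the set of all bounded maps $\mathbb{K}\to\mathbb{R}$ and $\mathfrak{U}$ the set of all bounded maps $\Omega\to\mathbb{R}$. A game mapping is a map $\mathbb{V}:\mathfrak{C}\to\mathfrak{U}$ such that $\mathbb{V}[Ac+B]=A\mathbb{V}[c]+B$ for all $c\in\mathfrak{C}$, $A\ge0$, $B\in\mathbb{R}$, and such that $c_1(z)\le c_2(z)$ for all $z\in\mathbb{K}$ implies $\mathbb{V}[c_1](\omega)\le\mathbb{V}[c_2](\omega)$ for all $\omega\in\Omega$. $\mathfrak{D}$ is the set of probability densities supported in $\mathbb{R}_+$ (Lebesgue integrable $\varrho:\mathbb{R}_+\to\mathbb{R}_+$ with $\int_0^\infty\varrho=1$). For $\varrho\in\mathfrak{D}$ and $T>0$ with $\int_T^\infty\varrho(t)dt>0$, $\varrho^T_{\mathrm{shift}}(t):=\varrho(t+T)/\int_T^\infty\varrho(s)ds$; for $\lambda>0$, $\varrho^\lambda_{\mathrm{scale}}(t):=\lambda\varrho(\lambda t)$. For $\varrho\in\mathfrak{D}$,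 $c[\varrho](z):=\int_0^\infty\varrho(t)g(z(t))dt$, $z\in\mathbb{K}$. For $\varrho\in\mathfrak{D}$, $T>0$ with $\int_T^\infty\varrho>0$, define $d[\varrho,T](z):=\int_0^T\varrho(t)g(z(t))dt+\int_T^\infty\varrho(t)dt\cdot\mathbb{V}\big[c[\varrho^T_{\mathrm{shift}}]\big](z(T))$. $\mathbb{V}$ satisfies the dynamic programming principle on $\mathfrak{D}$ if $\mathbb{V}[d[\varrho,T]]=\mathbb{V}[c[\varrho]]$ for all $\varrho\in\mathfrak{D}$, $T>0$ with $\int_T^\infty\varrho>0$. Densities: $\varpi_T(t)=\frac1T1_{[0,T]}(t)$, $\pi_\lambda(t)=\lambda e^{-\lambda t}$ ($T,\lambda>0$). A density $\varrho\in\mathfrak{D}$ is a power density if $\varrho(t)=(\alpha+\beta t)^{-\gamma}$ for all $t\ge0$ for some $\alpha,\beta,\gamma>0$. *)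

(* Defs.v *)
From HB Require Import structures.
From mathcomp Require Import all_boot all_order all_algebra.
From mathcomp Require Import all_classical all_reals all_analysis.
Set Implicit Arguments. Unset Strict Implicit. Unset Printing Implicit Defensive.
Import Order.TTheory GRing.Theory Num.Theory.
Import numFieldNormedType.Exports.
Local Open Scope classical_set_scope.
Local Open Scope ring_scope.

Section Defs.
Context {R : realType}.

Definition leb := @completed_lebesgue_measure R.
(* R with the sigma-algebra of Lebesgue measurable sets *)
Definition LR := caratheodory_type (R:=R) (wlength (@idfun R))^*%mu.

(* Lebesgue measurability (Lebesgue sets in the domain, Borel in the codomain) *)
Definition Lmeasurable_on (D : set R) (f : R -> R) : Prop :=
  measurable_fun (D : set LR) (f : LR -> R).

Definition Rplus : set R := `[0, +oo[.

Definition LInt (D : set R) (f : R -> R) : R := fine (\int[leb]_(t in D) (f t)%:E).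

Definition bounded_on {T : Type} (A : set T) (f : T -> R) : Prop :=
  exists M : R, forall x, A x -> `|f x| <= M.

(* Trajectories z : R_+ -> Omega are represented by maps R -> Omega (only
   the values on [0,+oo[ are ever used); K is a set of such maps; a map
   c : K -> R is represented by a map (R -> Omega) -> R (only its values on K
   matter). *)
Definition game_mapping {Omega : Type} (K : set (R -> Omega))
    (V : ((R -> Omega) -> R) -> Omega -> R) : Prop :=
  [/\ (forall c, bounded_on K c -> bounded_on setT (V c)),
      (forall c (A B : R), bounded_on K c -> 0 <= A ->
          V (fun z => A * c z + B) = (fun w => A * V c w + B))
    & (forall c1 c2, bounded_on K c1 -> bounded_on K c2 ->
          (forall z, K z -> c1 z <= c2 z) -> forall w, V c1 w <= V c2 w)].

Definition is_density (rho : R -> R) : Prop :=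
  [/\ forall t, 0 <= t -> 0 <= rho t,
      leb.-integrable Rplus (fun t => (rho t)%:E)
    & (\int[leb]_(t in Rplus) (rho t)%:E)%E = 1%E].

Definition rho_shift (rho : R -> R) (T : R) : R -> R :=
  fun t => rho (t + T) / LInt `[T, +oo[ rho.

Definition rho_scale (rho : R -> R) (lambda : R) : R -> R :=
  fun t => lambda * rho (lambda * t).

Definition varpi (T : R) : R -> R :=
  fun t => if (0 <= t <= T) then T^-1 else 0.

Definition pi_exp (lambda : R) : R -> R :=
  fun t => lambda * expR (- (lambda * t)).

Definition power_density (rho : R -> R) : Prop :=
  is_density rho /\
  exists alpha beta gamma : R, [/\ 0 < alpha, 0 < beta, 0 < gamma &
    forall t, 0 <= t -> rho t = (alpha + beta * t) `^ (- gamma)].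

Definition piecewise_continuous (mu : R -> R) : Prop :=
  (forall a b : R, 0 < a -> finite_set
      [set x | a <= x <= b /\ ~ {for x, continuous mu}]) /\
  (forall x : R, 0 < x ->
      cvg (mu y @[y --> x^'-]) /\ cvg (mu y @[y --> x^'+])).

Section Game.
Context {Omega : Type} (g : Omega -> R).

Definition cost (rho : R -> R) : (R -> Omega) -> R :=
  fun z => LInt `[0, +oo[ (fun t => rho t * g (z t)).

Definition dpp_cost (V : ((R -> Omega) -> R) -> Omega -> R)
    (rho : R -> R) (T : R) : (R -> Omega) -> R :=
  fun z => LInt `[0, T[ (fun t => rho t * g (z t))
           + LInt `[T, +oo[ rho * V (cost (rho_shift rho T)) (z T).

Definition satisfies_dpp (V : ((R -> Omega) -> R) -> Omega -> R) : Prop :=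
  forall rho T, is_density rho -> 0 < T -> 0 < LInt `[T, +oo[ rho ->
    V (dpp_cost V rho T) = V (cost rho).

End Game.

Definition unif_to_0 {Omega : Type} (f : R -> Omega -> R) (U : Omega -> R) :=
  forall e : R, 0 < e -> exists d : R, 0 < d /\
    forall x, 0 < x < d -> forall w, `|f x w - U w| <= e.

Definition unif_to_oo {Omega : Type} (f : R -> Omega -> R) (U : Omega -> R) :=
  forall e : R, 0 < e -> exists M : R,
    forall x, M < x -> forall w, `|f x w - U w| <= e.

End Defs.

(* Main.v *)
Require Import Defs.
From HB Require Import structures.
From mathcomp Require Import all_boot all_order all_algebra.
From mathcomp Require Import all_classical all_reals all_analysis.
From mathcomp Require Import measurable_realfun ring lra.
Import Order.TTheory GRing.Theory Num.Theory.
Import numFieldNormedType.Exports.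
Local Open Scope classical_set_scope.
Local Open Scope ring_scope.

(** Call a density [f] good when its scalings [rho_scale f l] have the uniform
    limit [U] as [l] tends to [0]; the limits along [varpi], [pi_exp] and the
    shifts of a power density say that [varpi 1], [pi_exp 1] and the power
    density are good.  The value is Lipschitz for the [L^1] distance, so good
    densities are closed in [L^1].  By the dynamic programming principle, two
    densities that coincide up to time [d] have close values as soon as their
    shifts by [d] do; hence, if [h], the shift of [h] by [d] and [k] are good,
    so is the density [concat h d k] that follows [h] up to [d] and continues
    as a copy of [k].
    The three model densities are self-similar: each shift is a scaling, hence
    good with the density itself.  Concatenating short initial pieces of a good
    self-similar density along the points [1 - q ^ n] approximates [varpi 1] in
    [L^1].  Conversely, once [varpi 1] is good, so are all positive step
    densities, and these are dense in [L^1]. *)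

(** * Integration of Borel functions against the completed Lebesgue measure *)

Section LebesgueIntegral.
Set Implicit Arguments.
Unset Strict Implicit.
Context {R : realType}.
Local Open Scope ereal_scope.
Local Notation BR := (measurableTypeR R).

Lemma borel_Lmeasurable (D : set R) :
  measurable D -> measurable (D : set (@LR R)).
Proof.
move=> mD; exact: sub_caratheodory.
Qed.

Lemma measurable_idL : measurable_fun [set: @LR R] (idfun : @LR R -> BR).
Proof. by move=> _ A mA; rewrite setTI; exact: borel_Lmeasurable. Qed.

Lemma borel_Lmeasurable_fun d (T : measurableType d) (D : set R) (f : R -> T) :
  measurable D ->
  measurable_fun D f -> measurable_fun (D : set (@LR R)) f.
Proof.
by move=> mD mf _ A mA; apply: borel_Lmeasurable; exact: mf.
Qed.

(** The identity from the Lebesgue to the Borel sigma-algebra is measurable and pushes [leb] forward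
    to [lebesgue_measure]. *)
Lemma integral_lebE (D : set R) (f : R -> \bar R) :
  measurable D -> measurable_fun D f ->
  (forall x, D x -> 0 <= f x) ->
  \int[leb]_(x in D) f x = \int[lebesgue_measure]_(x in D) f x.
Proof.
move=> mD mf f0.
have -> : \int[leb]_(x in D) f x =
    \int[leb]_(x in (idfun : @LR R -> BR) @^-1` D) (f \o idfun) x by [].
rewrite -(ge0_integral_pushforward measurable_idL)//.
by move=> y /[!inE]; exact: f0.
Qed.

(** Both sides are measures in [A] that agree on the intervals []c, d]], whose preimages have length
    [(d - c) / a]; uniqueness of Lebesgue measure concludes. *)
Lemma lebesgue_measure_affine (a b : R) (A : set R) : (0 < a)%R ->
  measurable A ->
  a%:E * pushforward lebesgue_measure (fun t : BR => (a * t + b)%R : BR) A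
  = lebesgue_measure A.
Proof.
move=> a0 mA.
have mphi : measurable_fun [set: BR] (fun t : BR => (a * t + b)%R : BR).
  apply: measurable_funD => //; apply: measurable_funM => //.
pose mu : {measure set BR -> \bar R} :=
  mscale (NngNum (ltW a0)) (pushforward lebesgue_measure (fun t : BR => (a * t + b)%R : BR)).
rewrite -[LHS]/(mu mphi A); apply/esym/lebesgue_measure_unique => //= _ [[c d]] _ <-.
rewrite /mu /mscale/= /pushforward.
have -> : (fun t : R => (a * t + b)%R) @^-1` `]c, d] = `]((c - b) / a)%R, ((d - b) / a)%R]%classic.
  apply/seteqP; split=> x /=; rewrite !in_itv/= ltr_pdivrMr// ler_pdivlMr// => /andP[h1 h2];
    apply/andP; split; lra.
rewrite !lebesgue_measure_itv/= !lte_fin ltr_pM2r ?invr_gt0// ltrD2r.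
case: ifPn; rewrite ?mule0// => _.
by rewrite -!EFinD -EFinM; congr EFin; field; rewrite gt_eqF.
Qed.

(** Change of variables by pushforward; the half-line form serves both the scalings ([b = 0]) and
    the shifts ([a = 1]) of densities. *)
Lemma integral_affine (a b c : R) (f : R -> \bar R) : (0 < a)%R ->
  measurable_fun `[(a * c + b)%R, +oo[ f ->
  (forall x, (a * c + b <= x)%R -> 0 <= f x) ->
  a%:E * \int[leb]_(t in `[c, +oo[) f (a * t + b)%R =
  \int[leb]_(t in `[(a * c + b)%R, +oo[) f t.
Proof.
move=> a0 mf f0.
have mphi : measurable_fun [set: BR] (fun t : BR => (a * t + b)%R : BR).
  by apply: measurable_funD => //; exact: measurable_funM.
have E : (fun t : BR => (a * t + b)%R : BR) @^-1` `[(a * c + b)%R, +oo[ = `[c, +oo[%classic.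
  by apply/seteqP; split=> x /=; rewrite !in_itv/= !andbT lerD2r ler_pM2l.
have f0' x : `[(a * c + b)%R, +oo[%classic x -> 0 <= f x.
  by rewrite /= in_itv/= andbT; exact: f0.
rewrite !integral_lebE//; last 2 first.
- apply: (measurable_comp (F := `[(a * c + b)%R, +oo[%classic)) => //.
  + by move=> _ [x + <-]; rewrite /= !in_itv/= !andbT lerD2r ler_pM2l.
  + exact: measurable_funTS.
- by move=> x; rewrite /= in_itv/= andbT => cx; apply: f0; rewrite lerD2r ler_pM2l.
rewrite -E -(ge0_integral_pushforward mphi)//; last by move=> y /[!inE]; exact: f0'.
have nn : (0 <= a)%R := ltW a0.
rewrite -(ge0_integral_mscale _ _ (NngNum nn))//.
by apply: eq_measure_integral => A mA _; exact: lebesgue_measure_affine.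
Qed.

Lemma leb_integralZl (D : set R) (f : R -> R) (k : R) : measurable D ->
  measurable_fun D f -> (forall t, D t -> 0 <= f t)%R -> (0 <= k)%R ->
  \int[leb]_(t in D) (k * f t)%:E = k%:E * \int[leb]_(t in D) (f t)%:E.
Proof.
move=> mD mf f0 k0; under eq_integral do rewrite EFinM.
apply: ge0_integralZl_EFin.
- exact: borel_Lmeasurable.
- by move=> t Dt; rewrite lee_fin f0.
- by apply: borel_Lmeasurable_fun => //; exact/measurable_EFinP.
- exact: k0.
Qed.

Lemma leb_subset_integral (A B : set R) (f : R -> R) : measurable A -> measurable B ->
  measurable_fun B f -> (forall t, B t -> 0 <= f t)%R -> A `<=` B ->
  \int[leb]_(t in A) (f t)%:E <= \int[leb]_(t in B) (f t)%:E.
Proof.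
move=> mA mB mf f0 AB; apply: ge0_subset_integral.
- exact: borel_Lmeasurable.
- exact: borel_Lmeasurable.
- by apply: borel_Lmeasurable_fun => //; exact/measurable_EFinP.
- by move=> t Bt; rewrite lee_fin f0.
- exact: AB.
Qed.

Lemma leb_le_integral (D : set R) (f g : R -> R) : measurable D ->
  measurable_fun D f -> measurable_fun D g ->
  (forall t, D t -> 0 <= f t <= g t)%R ->
  \int[leb]_(t in D) (f t)%:E <= \int[leb]_(t in D) (g t)%:E.
Proof.
move=> mD mf mg fg; apply: ge0_le_integral.
- exact: borel_Lmeasurable.
- by move=> t Dt; rewrite lee_fin; case/andP: (fg t Dt).
- by apply: borel_Lmeasurable_fun => //; exact/measurable_EFinP.
- by apply: borel_Lmeasurable_fun => //; exact/measurable_EFinP.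
- by move=> t Dt; rewrite lee_fin; case/andP: (fg t Dt).
Qed.

Lemma leb_integralD (D : set R) (f g : R -> R) : measurable D ->
  measurable_fun D f -> measurable_fun D g ->
  (forall t, D t -> 0 <= f t)%R -> (forall t, D t -> 0 <= g t)%R ->
  \int[leb]_(t in D) (f t + g t)%:E =
  \int[leb]_(t in D) (f t)%:E + \int[leb]_(t in D) (g t)%:E.
Proof.
move=> mD mf mg f0 g0; under eq_integral do rewrite EFinD.
apply: ge0_integralD.
- exact: borel_Lmeasurable.
- by move=> t Dt; rewrite lee_fin f0.
- by apply: borel_Lmeasurable_fun => //; exact/measurable_EFinP.
- by move=> t Dt; rewrite lee_fin g0.
- by apply: borel_Lmeasurable_fun => //; exact/measurable_EFinP.
Qed.

End LebesgueIntegral.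

(** * Borel densities: scaling, shifting, concatenation, L^1 distance *)

Section Densities.
Set Implicit Arguments.
Unset Strict Implicit.
Context {R : realType}.
Implicit Types (f h k : R -> R) (a c d l t T : R).

(** Borel measurability survives affine substitutions and gives access to the change of variables
    above; power densities and piecewise continuous densities have it. *)
Definition borel_density f := is_density f /\ measurable_fun Rplus f.

Lemma measurable_Rplus : measurable (@Rplus R).
Proof. exact: measurable_itv. Qed.
#[local] Hint Resolve measurable_Rplus : core.

Lemma Rplus_sub T : 0 <= T -> `[T, +oo[%classic `<=` @Rplus R.
Proof.
by move=> T0 t; rewrite /Rplus /= !in_itv/= !andbT; exact: le_trans.
Qed.

Lemma measurable_tail f T : 0 <= T -> measurable_fun Rplus f ->
  measurable_fun `[T, +oo[ f.
Proof. by move=> T0; apply: measurable_funS => //; exact: Rplus_sub. Qed.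

Lemma measurable_affine f l c : 0 < l -> 0 <= c -> measurable_fun Rplus f ->
  measurable_fun Rplus (fun t => f (l * t + c)).
Proof.
move=> l0 c0 mf; apply: (measurable_comp (F := Rplus)) => //.
  move=> _ [t + <-]; rewrite /Rplus /= !in_itv/= !andbT => t0.
  by rewrite addr_ge0// mulr_ge0// ltW.
by apply: measurable_funD => //; exact: measurable_funM.
Qed.

Lemma borel_densityP f : measurable_fun Rplus f -> (forall t, 0 <= t -> 0 <= f t) ->
  (\int[leb]_(t in Rplus) (f t)%:E = 1)%E -> borel_density f.
Proof.
move=> mf f0 f1; split => //; split => //; apply/integrableP; split.
  by apply/borel_Lmeasurable_fun => //; exact/measurable_EFinP.
under eq_integral.
  move=> t; rewrite inE /Rplus /= in_itv/= andbT => t0.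
  rewrite ger0_norm ?f0//; over.
by rewrite f1 ltry.
Qed.

Lemma integral_scale f l c : 0 < l -> 0 <= c -> measurable_fun Rplus f ->
  (forall t, 0 <= t -> 0 <= f t) ->
  (\int[leb]_(t in `[c, +oo[) (rho_scale f l t)%:E =
   \int[leb]_(t in `[(l * c)%R, +oo[) (f t)%:E)%E.
Proof.
move=> l0 c0 mf f0; have lc0 : 0 <= l * c by rewrite mulr_ge0// ltW.
have /= := @integral_affine R l 0 c (EFin \o f) l0; rewrite addr0 => <-; last 2 first.
- by apply/measurable_EFinP; exact: measurable_tail.
- by move=> t t0; rewrite lee_fin f0// (le_trans lc0).
rewrite -leb_integralZl.
- by apply: eq_integral => t _; rewrite /rho_scale addr0.
- exact: measurable_itv.
- by apply: measurable_tail => //; exact: measurable_affine.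
- by move=> t; rewrite /= in_itv/= andbT => ct; rewrite f0// addr0 mulr_ge0// ?(ltW l0)// (le_trans c0).
- exact: ltW.
Qed.

Lemma integral_shift f T : 0 <= T -> measurable_fun Rplus f ->
  (forall t, 0 <= t -> 0 <= f t) ->
  (\int[leb]_(t in Rplus) (f (t + T)%R)%:E =
   \int[leb]_(t in `[T, +oo[) (f t)%:E)%E.
Proof.
move=> T0 mf f0.
have /= := @integral_affine R 1 T 0 (EFin \o f) ltr01; rewrite mul1r add0r => <-; last 2 first.
- by apply/measurable_EFinP; exact: measurable_tail.
- by move=> t t0; rewrite lee_fin f0// (le_trans T0).
by rewrite mul1e; apply: eq_integral => t _; rewrite mul1r.
Qed.

Lemma Rplus_split T : 0 <= T -> @Rplus R = `[0, T[%classic `|` `[T, +oo[%classic.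
Proof.
move=> T0; apply/seteqP; split=> t; rewrite /Rplus /= !in_itv/= !andbT.
  by move=> t0; case: (ltP t T) => tT; [left|right] => //; rewrite t0.
by move=> [/andP[]//|]; exact: le_trans.
Qed.

Lemma integral_split (f : R -> \bar R) T : 0 <= T ->
  measurable_fun (Rplus : set LR) f ->
  (forall t, 0 <= t -> (0 <= f t)%E) ->
  (\int[leb]_(t in Rplus) f t =
   \int[leb]_(t in `[0%R, T[) f t + \int[leb]_(t in `[T, +oo[) f t)%E.
Proof.
move=> T0 mf f0; rewrite (Rplus_split T0) ge0_integral_setU//=.
- exact: borel_Lmeasurable.
- exact: borel_Lmeasurable.
- by rewrite -Rplus_split.
- move=> t [|]; rewrite in_itv/=; first by case/andP => /f0.
  by rewrite andbT => /(le_trans T0)/f0.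
- apply/disj_setPS => t /= []; rewrite !in_itv/= andbT => /andP[_].
  by rewrite ltNge => /negP.
Qed.

Lemma borel_density_Lmeasurable f : borel_density f ->
  measurable_fun (Rplus : set LR) (EFin \o f).
Proof.
by move=> [_ mf]; apply: borel_Lmeasurable_fun => //; exact/measurable_EFinP.
Qed.

Lemma tail_bounds f T : borel_density f -> 0 <= T ->
  (0 <= \int[leb]_(t in `[T, +oo[) (f t)%:E <= 1)%E.
Proof.
move=> df T0; have [[f0 _ f1] mf] := df; apply/andP; split.
  by apply: integral_ge0 => t /= /(Rplus_sub T0); rewrite /Rplus /= in_itv/= andbT lee_fin; exact: f0.
rewrite -f1; apply: leb_subset_integral => //; last exact: Rplus_sub.
by move=> t; rewrite /Rplus /= in_itv/= andbT; exact: f0.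
Qed.

(** [LInt] passes through [fine], which sends infinite values to [0]; the bound of the tail by [1]
    rules this out. *)
Lemma tailE f T : borel_density f -> 0 <= T ->
  ((LInt `[T, +oo[ f)%:E = \int[leb]_(t in `[T, +oo[) (f t)%:E)%E.
Proof.
move=> df T0; have /andP[h0 h1] := tail_bounds df T0.
by rewrite /LInt fineK// ge0_fin_numE// (le_lt_trans h1)// ltry.
Qed.

Lemma tail_ge0 f T : borel_density f -> 0 <= T -> 0 <= LInt `[T, +oo[ f.
Proof. by move=> df T0; rewrite -lee_fin tailE//; case/andP: (tail_bounds df T0). Qed.

Lemma tail_le1 f T : borel_density f -> 0 <= T -> LInt `[T, +oo[ f <= 1.
Proof. by move=> df T0; rewrite -lee_fin tailE//; case/andP: (tail_bounds df T0). Qed.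

Lemma borel_density_scale f l : 0 < l -> borel_density f ->
  borel_density (rho_scale f l).
Proof.
move=> l0 [[f0 _ f1] mf]; apply: borel_densityP.
- apply: measurable_funM => //; have := measurable_affine l0 (lexx 0) mf.
  by apply: eq_measurable_fun => t _; rewrite addr0.
- by move=> t t0; rewrite /rho_scale mulr_ge0 ?f0 ?mulr_ge0// ltW.
- by rewrite integral_scale// mulr0.
Qed.

Lemma tail_scale f l c : 0 < l -> 0 <= c -> borel_density f ->
  LInt `[c, +oo[ (rho_scale f l) = LInt `[l * c, +oo[ f.
Proof.
move=> l0 c0 [[f0 _ f1] mf]; apply/EFin_inj.
by congr EFin; congr fine; exact: integral_scale.
Qed.

Lemma borel_density_shift f T : 0 <= T -> 0 < LInt `[T, +oo[ f ->
  borel_density f -> borel_density (rho_shift f T).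
Proof.
move=> T0 FT df; have [[f0 _ f1] mf] := df; have FT0 := ltW FT.
have mfT : measurable_fun Rplus (fun t => f (t + T)).
  have := measurable_affine ltr01 T0 mf.
  by apply: eq_measurable_fun => t _; rewrite mul1r.
have fT0 t : 0 <= t -> 0 <= f (t + T) by move=> t0; rewrite f0// addr_ge0.
apply: borel_densityP.
- exact: measurable_funM.
- by move=> t t0; rewrite /rho_shift mulr_ge0 ?invr_ge0// fT0.
- under eq_integral do rewrite /rho_shift mulrC.
  rewrite leb_integralZl ?invr_ge0//.
  + by rewrite integral_shift// -tailE// -EFinM mulVf// gt_eqF.
  + by move=> t; rewrite /Rplus /= in_itv/= andbT; exact: fT0.
Qed.

(** The factor in front of [k] is the mass that [h] leaves beyond [d]: it keeps the total mass equal
    to [1] and, when positive, makes [k] the shift of the result by [d]. *)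
Definition concat h d k : R -> R :=
  fun t => if t < d then h t else LInt `[d, +oo[ h * k (t - d).

Lemma measurable_concat h d k : 0 <= d -> measurable_fun Rplus h ->
  measurable_fun Rplus k -> measurable_fun Rplus (concat h d k).
Proof.
move=> d0 mh mk; rewrite (Rplus_split d0); apply/measurable_funU => //; split.
  apply: (@eq_measurable_fun _ _ _ _ _ h).
    by move=> t; rewrite inE /concat/= in_itv/= => /andP[_ ->].
  by apply: measurable_funS mh => //; rewrite (Rplus_split d0); exact: subsetUl.
apply: (@eq_measurable_fun _ _ _ _ _ (fun t => LInt `[d, +oo[ h * k (t - d))).
  by move=> t; rewrite inE /concat/= in_itv/= andbT ltNge => ->.
apply: measurable_funM => //; apply: (measurable_comp (F := Rplus)) => //.
  by move=> _ [t + <-]; rewrite /Rplus /= !in_itv/= !andbT subr_ge0.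
exact: measurable_funD.
Qed.

Lemma concat_ge0 h d k t : 0 <= d -> borel_density h -> borel_density k ->
  0 <= t -> 0 <= concat h d k t.
Proof.
move=> d0 dh [[k0 _ _] _] t0; rewrite /concat; case: ltP => td.
  by have [[h0 _ _] _] := dh; exact: h0.
by rewrite mulr_ge0 ?tail_ge0// k0// subr_ge0.
Qed.

Lemma integral_tail_concat h d k : 0 <= d -> borel_density h -> borel_density k ->
  (\int[leb]_(t in `[d, +oo[) (concat h d k t)%:E =
   \int[leb]_(t in `[d, +oo[) (h t)%:E)%E.
Proof.
move=> d0 dh dk; have [[h0 _ h1] mh] := dh; have [[k0 _ k1] mk] := dk.
rewrite -integral_shift//; last 2 first.
- exact: measurable_concat.
- by move=> t; exact: concat_ge0.
have -> : (\int[leb]_(t in Rplus) (concat h d k (t + d)%R)%:E =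
    \int[leb]_(t in Rplus) (LInt `[d, +oo[ h * k t)%:E)%E.
  apply: eq_integral => t; rewrite inE /concat/Rplus/= in_itv/= andbT => t0.
  by rewrite ltNge lerDr t0/= addrK.
rewrite leb_integralZl ?tail_ge0//; last first.
  by move=> t; rewrite /Rplus/= in_itv/= andbT => /k0.
by rewrite k1 mule1 tailE.
Qed.

Lemma borel_density_concat h d k : 0 <= d -> borel_density h ->
  borel_density k -> borel_density (concat h d k).
Proof.
move=> d0 dh dk; have [[h0 _ h1] mh] := dh; have [_ mk] := dk.
have mc := measurable_concat d0 mh mk.
have c0 t : 0 <= t -> 0 <= concat h d k t by exact: concat_ge0.
apply: borel_densityP => //.
have mcL := borel_Lmeasurable_fun measurable_Rplus (proj2 (measurable_EFinP _ _) mc).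
rewrite (integral_split d0 mcL c0) integral_tail_concat//.
rewrite -h1 (integral_split d0 (borel_density_Lmeasurable dh) h0); congr adde.
by apply: eq_integral => t; rewrite inE /concat/= in_itv/= => /andP[_ ->].
Qed.

Lemma tail_concat h d k : 0 <= d -> borel_density h -> borel_density k ->
  LInt `[d, +oo[ (concat h d k) = LInt `[d, +oo[ h.
Proof. by move=> d0 dh dk; rewrite /LInt integral_tail_concat. Qed.

Lemma shift_concat h d k t : 0 <= d -> borel_density h -> borel_density k ->
  0 < LInt `[d, +oo[ h -> 0 <= t -> rho_shift (concat h d k) d t = k t.
Proof.
move=> d0 dh dk F0 t0; rewrite /rho_shift tail_concat// /concat.
by rewrite ltNge lerDr t0/= addrK mulrAC divff ?mul1r// gt_eqF.
Qed.

Definition dist f h := (\int[leb]_(t in Rplus) `|f t - h t|%:E)%E.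

Lemma measurable_dist f h : measurable_fun Rplus f -> measurable_fun Rplus h ->
  measurable_fun Rplus (fun t => `|f t - h t|).
Proof.
by move=> mf mh; apply: measurableT_comp => //; exact: measurable_funB.
Qed.

(** By change of variables scaling is an isometry of L^1, so an approximation is equally good at all
    scales. *)
Lemma dist_scale f h l : 0 < l -> measurable_fun Rplus f ->
  measurable_fun Rplus h -> dist (rho_scale f l) (rho_scale h l) = dist f h.
Proof.
move=> l0 mf mh; have := integral_scale l0 (lexx 0) (measurable_dist mf mh).
rewrite mulr0 /dist /Rplus => <-//; apply: eq_integral => t _.
by rewrite /rho_scale -mulrBr normrM gtr0_norm.
Qed.

End Densities.

(** * The uniform density on the unit interval, and self-similar densities *)

Section UniformDensity.
Set Implicit Arguments.
Unset Strict Implicit.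
Context {R : realType}.
Implicit Types (f h k : R -> R) (a c d l t T : R).

Lemma RplusP t : @Rplus R t <-> 0 <= t.
Proof. by rewrite /Rplus/= in_itv/= andbT. Qed.

Lemma leb_integral_cst c d : 0 <= c -> 0 <= d ->
  (\int[leb]_(t in `[0%R, d[) c%:E = (c * d)%:E)%E.
Proof.
move=> c0 d0; rewrite integral_lebE//.
  rewrite integral_cst//= lebesgue_measure_itv/= lte_fin.
  by case: ltgtP d0 => // [_|<-] _; rewrite ?mulr0 ?mule0// -EFinD subr0.
Qed.

Lemma dist_sym f h : dist f h = dist h f.
Proof. by apply: eq_integral => t _; rewrite distrC. Qed.

Lemma dist_le2 f h : borel_density f -> borel_density h -> (dist f h <= 2%:E)%E.
Proof.
move=> [[f0 _ f1] mf] [[h0 _ h1] mh]; have mR := @measurable_Rplus R.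
apply: (@le_trans _ _ (\int[leb]_(t in Rplus) (f t + h t)%:E)%E).
  apply: leb_le_integral => //; [exact: measurable_dist|exact: measurable_funD|].
  move=> t /RplusP t0; rewrite normr_ge0/=.
  by rewrite (le_trans (ler_normB _ _))// !ger0_norm ?f0 ?h0.
rewrite leb_integralD//; [by rewrite f1 h1 -EFinD|by move=> t /RplusP/f0|by move=> t /RplusP/h0].
Qed.

Lemma dist_split f h d : 0 <= d -> measurable_fun Rplus f -> measurable_fun Rplus h ->
  (dist f h = \int[leb]_(t in `[0%R, d[) `|f t - h t|%:E +
              \int[leb]_(t in `[d, +oo[) `|f t - h t|%:E)%E.
Proof.
move=> d0 mf mh; apply: (integral_split (f := fun t => `|f t - h t|%:E) d0).
  apply: borel_Lmeasurable_fun; first exact: measurable_Rplus.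
  by apply/measurable_EFinP; exact: measurable_dist.
by move=> t _.
Qed.

(** Equal tail masses give both continuations the same factor, so their distance is contracted by
    it; this drives the recursion in [good_varpi1]. *)
Lemma dist_concat h h' d k k' : 0 <= d ->
  borel_density h -> borel_density h' -> borel_density k -> borel_density k' ->
  LInt `[d, +oo[ h = LInt `[d, +oo[ h' ->
  (dist (concat h d k) (concat h' d k') =
   \int[leb]_(t in `[0%R, d[) `|h t - h' t|%:E + (LInt `[d, +oo[ h)%:E * dist k k')%E.
Proof.
move=> d0 dh dh' dk dk' hh'; have [_ mh] := dh; have [_ mh'] := dh'.
have [_ mk] := dk; have [_ mk'] := dk'.
have mc := measurable_concat d0 mh mk; have mc' := measurable_concat d0 mh' mk'.
rewrite (dist_split d0)//; congr adde.
  apply: eq_integral => t; rewrite inE/= in_itv/= => /andP[_ td].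
  by rewrite /concat td.
rewrite -(integral_shift (f := fun t => `|concat h d k t - concat h' d k' t|) d0)//; last first.
  exact: measurable_dist.
rewrite -leb_integralZl; [|exact: measurable_Rplus|exact: measurable_dist|by move=> t _|exact: tail_ge0].
apply: eq_integral => t; rewrite inE => /RplusP t0.
rewrite /concat ltNge lerDr t0/= addrK -hh' -mulrBr normrM ger0_norm//.
exact: tail_ge0.
Qed.

Lemma varpi1E t : 0 <= t -> varpi 1 t = if t <= 1 then 1 else 0 :> R.
Proof. by move=> t0; rewrite /varpi t0 invr1. Qed.

Lemma measurable_varpi1 : measurable_fun (@Rplus R) (varpi 1).
Proof.
apply: measurable_funTS; apply: measurable_fun_if => //.
by apply: measurable_and => //; exact: measurable_fun_ler.
Qed.

Lemma borel_density_varpi1 : borel_density (@varpi R 1).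
Proof.
apply: borel_densityP; first exact: measurable_varpi1.
  by move=> t t0; rewrite varpi1E//; case: ifP.
have mv := measurable_varpi1.
rewrite integral_lebE; last 3 first.
- exact: measurable_Rplus.
- exact/measurable_EFinP.
- by move=> t /RplusP t0; rewrite varpi1E//; case: ifP.
transitivity (\int[lebesgue_measure]_(t in `[0%R, 1%R]) (cst (1%:E : \bar R)) t)%E.
  rewrite [RHS]integral_mkcond [LHS]integral_mkcond; apply: eq_integral => t _.
  rewrite !patchE; case: ifPn; rewrite ?inE ?notin_setE.
    move=> /RplusP t0; rewrite varpi1E//; case: ifPn => t1.
      by rewrite mem_set//= in_itv/= t0.
    by rewrite memNset//= in_itv/= t0 (negbTE t1).
  move=> /RplusP/negP; rewrite -ltNge => t0; rewrite memNset//= in_itv/=.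
  by rewrite leNgt t0.
by rewrite integral_cst//= lebesgue_measure_itv/= lte_fin ltr01 mul1e -EFinD subr0.
Qed.

Lemma tail_varpi1 d : 0 <= d <= 1 -> LInt `[d, +oo[ (@varpi R 1) = 1 - d.
Proof.
move=> /andP[d0 d1]; have dv := borel_density_varpi1; have [[v0 _ v1] mv] := dv.
apply: EFin_inj; rewrite tailE// EFinB.
have := v1; rewrite (integral_split d0 (borel_density_Lmeasurable dv) v0).
have -> : (\int[leb]_(t in `[0%R, d[) (@varpi R 1 t)%:E = d%:E)%E.
  rewrite -[d in RHS]mul1r -leb_integral_cst//; apply: eq_integral => t.
  rewrite inE/= in_itv/= => /andP[t0 td].
  by rewrite varpi1E// (le_trans (ltW td) d1).
by move=> <-; rewrite addeAC subee// add0e.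
Qed.

Lemma tail_varpi1_eq0 d : 1 <= d -> LInt `[d, +oo[ (@varpi R 1) = 0.
Proof.
move=> d1; have dv := borel_density_varpi1; have [[v0 _ v1] mv] := dv.
have d0 : 0 <= d := le_trans ler01 d1.
apply/eqP; rewrite eq_le tail_ge0// andbT -(subrr 1) -(tail_varpi1 (d := 1)) ?ler01 ?lexx//.
rewrite -lee_fin !tailE//; apply: leb_subset_integral => //.
- exact: measurable_tail.
- by move=> t; rewrite /= in_itv/= andbT => t1; apply: v0; exact: le_trans t1.
- by move=> t; rewrite /= !in_itv/= !andbT; exact: le_trans.
Qed.

(** Positivity and right continuity at [0] make short initial pieces nearly constant; the last
    clause lets shifts inherit limits along scalings. Equality is asked for [t >= 0] only, the
    values that costs see. *)
Definition self_similar f := [/\ borel_density f, 0 < f 0,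
  (forall e, 0 < e -> exists2 s, 0 < s & forall t, 0 <= t < s -> `|f t - f 0| <= e) &
  (forall T, 0 < T -> 0 < LInt `[T, +oo[ f ->
    exists2 l, 0 < l & forall t, 0 <= t -> rho_shift f T t = rho_scale f l t)].

Lemma self_similar_varpi1 : self_similar (@varpi R 1).
Proof.
split; first exact: borel_density_varpi1.
- by rewrite varpi1E// ler01.
- move=> e e0; exists 1 => // t /andP[t0 t1].
  by rewrite !varpi1E// ler01 (ltW t1) subrr normr0 ltW.
- move=> T T0 FT; have T1 : T < 1.
    by rewrite ltNge; apply/negP => /tail_varpi1_eq0 E; rewrite E ltxx in FT.
  have T1' : 0 < 1 - T by rewrite subr_gt0.
  (* What remains of the uniform density on [[0, 1]] after [T] is uniform on [[0, 1 - T]]. *)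
  exists (1 - T)^-1; first by rewrite invr_gt0.
  move=> t t0; rewrite /rho_shift /rho_scale tail_varpi1 ?(ltW T0) ?(ltW T1)//.
  rewrite !varpi1E; last 2 first.
  - by rewrite mulr_ge0// invr_ge0 ltW.
  - by rewrite addr_ge0// ltW.
  rewrite (mulrC _ t) ler_pdivrMr// mul1r lerBrDr.
  by case: ifP; rewrite ?mulr1 ?mul1r ?mulr0 ?mul0r.
Qed.

(** For small [s], [f] is nearly constant on [[0, s[] and has mass [1 - q] there. Scaling by [l]
    carries this piece to [[0, 1 - q[] with the same mass, so its mean is [1]; being nearly
    constant, it is close to [1]. *)
Lemma self_similar_flat f (e : R) : self_similar f -> 0 < e ->
  exists s, let q := LInt `[s, +oo[ f in let l := s / (1 - q) in
  [/\ 0 < s, 0 < q, q < 1 &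
    forall t, 0 <= t < 1 - q -> `|rho_scale f l t - 1| <= e].
Proof.
move=> [df f00 fc _] e0; have [[f0 _ f1] mf] := df.
(* [e1] bounds the relative oscillation of [f] on [[0, s[]: [e / 4] serves the final estimate,
   [1 / 2] keeps [1 - q] at least [f 0 * s / 2]. *)
pose e1 := Num.min (e / 4) (1 / 2).
have e1e : e1 <= e / 4 by rewrite /e1 ge_min lexx.
have e12 : e1 <= 1 / 2 by rewrite /e1 ge_min lexx orbT.
have e10 : 0 < e1 by rewrite /e1 lt_min !divr_gt0.
have [s0 s00 fs] := fc (e1 * f 0) (mulr_gt0 e10 f00).
(* The second bound gives [f 0 * s <= 1 / 2], hence [1 - q <= 3 / 4] and [q > 0]. *)
pose s := Num.min s0 (1 / (2 * f 0)).
have ss0 : s <= s0 by rewrite /s ge_min lexx.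
have s_gt0 : 0 < s by rewrite /s lt_min s00 divr_gt0// mulr_gt0.
have u12 : f 0 * s <= 1 / 2.
  have : s <= 1 / (2 * f 0) by rewrite /s ge_min lexx orbT.
  by rewrite ler_pdivlMr ?mulr_gt0// => h; rewrite ler_pdivlMr//; lra.
pose u := f 0 * s; have u0 : 0 < u by rewrite /u mulr_gt0.
exists s => q l.
have fb t : 0 <= t < s -> f 0 * (1 - e1) <= f t <= f 0 * (1 + e1).
  move=> /andP[t0 ts]; have := fs t; rewrite t0 (lt_le_trans ts ss0) => /(_ isT).
  by rewrite ler_norml => /andP[h1 h2]; apply/andP; split; lra.
have I0s : (\int[leb]_(t in `[0%R, s[) (f t)%:E = (1 - q)%:E)%E.
  have := f1; rewrite (integral_split (ltW s_gt0) (borel_density_Lmeasurable df) f0).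
  by rewrite -tailE ?(ltW s_gt0)// EFinB => <-; rewrite addeK.
have ms : measurable_fun `[0, s[ f.
  apply: measurable_funS mf; first exact: measurable_Rplus.
  by rewrite (Rplus_split (ltW s_gt0)); exact: subsetUl.
have p1 : u * (1 - e1) <= 1 - q.
  rewrite -lee_fin -I0s /u mulrAC -leb_integral_cst; [|by rewrite mulr_ge0 ?(ltW f00)//; lra|exact: ltW].
  apply: leb_le_integral => // t; rewrite /= in_itv/= => /fb/andP[-> _]; rewrite andbT.
  by rewrite mulr_ge0 ?(ltW f00)//; lra.
have p2 : 1 - q <= u * (1 + e1).
  rewrite -lee_fin -I0s /u mulrAC -leb_integral_cst; [|by rewrite mulr_ge0 ?(ltW f00)//; lra|exact: ltW].
  apply: leb_le_integral => // t; rewrite /= in_itv/= => h; have /andP[_ ->] := fb t h.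
  by rewrite andbT f0//; case/andP: h.
have p0 : 0 < 1 - q by apply: lt_le_trans p1; rewrite mulr_gt0//; lra.
have q0 : 0 < q.
  have : u * (1 + e1) <= 1 / 2 * (1 + 1 / 2) by rewrite ler_pM// ?(ltW u0)//; lra.
  lra.
split => //; first by rewrite -subr_gt0.
move=> t /andP[t0 tq].
have lt0 : 0 <= l * t < s.
  rewrite mulr_ge0//=; last by rewrite divr_ge0// ltW.
  by rewrite /l mulrAC ltr_pdivrMr// ltr_pM2l.
have -> : rho_scale f l t - 1 = (s * f (l * t) - (1 - q)) / (1 - q).
  by rewrite /rho_scale /l; field; rewrite gt_eqF.
rewrite normrM normfV (gtr0_norm p0) ler_pdivrMr//.
(* Both [s * f (l * t)] and [1 - q] lie between [u * (1 - e1)] and [u * (1 + e1)], so they differ by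
   at most [e * (u / 2)], which is at most [e * (1 - q)]. *)
have /andP[b1 b2] := fb _ lt0.
have uE c : u * c = s * (f 0 * c) by rewrite /u; ring.
have c1 : u * (1 - e1) <= s * f (l * t) by rewrite uE ler_pM2l.
have c2 : s * f (l * t) <= u * (1 + e1) by rewrite uE ler_pM2l.
have c3 : e * (u / 2) <= e * (1 - q).
  rewrite ler_pM2l//; apply: le_trans p1; rewrite ler_pM2l//; lra.
have c4 : u * e1 <= u * (e / 4) by rewrite ler_pM2l.
rewrite ler_norml; apply/andP; split; lra.
Qed.

End UniformDensity.

(** * Densities of positive step functions *)

Section StepDensities.
Set Implicit Arguments.
Unset Strict Implicit.
Context {R : realType}.
Implicit Types (f h k : R -> R) (a b c d l t T M : R) (s : seq R).

(** The normalising constant of [step]. *)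
Definition mass d a s := d * (a + \sum_(x <- s) x).

(* The density proportional to the step function that takes the successive
   values [a :: s] on consecutive intervals of length [d]. *)
Fixpoint step d a s : R -> R :=
  let u := rho_scale (varpi 1) (a / mass d a s) in
  if s is b :: s' then concat u d (step d b s') else u.

Lemma sum_seq_ge0 s : all (> 0) s -> 0 <= \sum_(x <- s) x.
Proof.
by move=> /allP s0; rewrite big_seq; apply: sumr_ge0 => x /s0/ltW.
Qed.

Lemma mass_gt0 d a s : 0 < d -> 0 < a -> all (> 0) s -> 0 < mass d a s.
Proof.
by move=> d0 a0 s0; rewrite mulr_gt0// ltr_pwDl// sum_seq_ge0.
Qed.

Lemma mass_cons d a b s : mass d a (b :: s) = d * a + mass d b s.
Proof. by rewrite /mass big_cons mulrDr. Qed.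

(** The scaled [varpi 1] is uniform on an interval of length [mass / a], which exceeds [d]; what it
    leaves beyond [d] is exactly the share of the remaining steps, so [concat] gives each step its
    right height. *)
Lemma tail_scale_varpi1 d a b s : 0 < d -> 0 < a -> 0 < b -> all (> 0) s ->
  LInt `[d, +oo[ (rho_scale (varpi 1) (a / mass d a (b :: s))) =
  mass d b s / mass d a (b :: s).
Proof.
move=> d0 a0 b0 s0; have m'0 := mass_gt0 d0 b0 s0.
have m0 : 0 < mass d a (b :: s) by rewrite mass_gt0//= b0.
rewrite tail_scale ?divr_gt0 ?(ltW d0)//; last exact: borel_density_varpi1.
have E : 1 - a / mass d a (b :: s) * d = mass d b s / mass d a (b :: s).
  rewrite mass_cons; field.
  by move: m0; rewrite mass_cons => m0; rewrite gt_eqF.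
rewrite tail_varpi1 ?E//; apply/andP; split.
  by rewrite mulr_ge0 ?divr_ge0// ltW.
by rewrite -subr_ge0 E divr_ge0// ltW.
Qed.

Lemma borel_density_step d a s : 0 < d -> 0 < a -> all (> 0) s ->
  borel_density (step d a s).
Proof.
move=> d0; elim: s a => [|b s IH] a a0 s0; have m0 := mass_gt0 d0 a0 s0.
  by apply: borel_density_scale; [rewrite divr_gt0|exact: borel_density_varpi1].
case/andP: s0 => b0 s0; apply: borel_density_concat; first exact: ltW.
  by apply: borel_density_scale; [rewrite divr_gt0|exact: borel_density_varpi1].
exact: IH.
Qed.

Lemma step_val d a s i t : 0 < d -> 0 < a -> all (> 0) s -> (i <= size s)%N ->
  i%:R * d <= t < i.+1%:R * d -> mass d a s * step d a s t = nth 0 (a :: s) i.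
Proof.
move=> d0; elim: s a i t => [|b s IH] a i t a0 s0 si /andP[ti1 ti2];
  have m0 := mass_gt0 d0 a0 s0; have am0 : 0 < a / mass d a _ := divr_gt0 a0 m0.
  move: si ti1 ti2; rewrite leqn0 => /eqP -> /=; rewrite mul0r mul1r => t0 td.
  rewrite /rho_scale varpi1E; last by rewrite mulr_ge0// ltW.
  rewrite ifT.
    by rewrite mulr1 mulrC divfK// gt_eqF.
  rewrite /mass big_nil addr0; rewrite mulrAC ler_pdivrMr ?mulr_gt0//.
  by rewrite mul1r mulrC ler_pM2r// ltW.
have /andP[b0 s0'] := s0; have m'0 := mass_gt0 d0 b0 s0'.
rewrite [step _ _ _]/= /concat tail_scale_varpi1//.
case: i si ti1 ti2 => [_|i si] ti1 ti2.
  rewrite mul1r in ti2; rewrite mul0r in ti1; rewrite ti2 /=.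
  rewrite /rho_scale varpi1E; last by rewrite mulr_ge0// ltW.
  rewrite ifT.
    by rewrite mulr1 mulrC divfK// gt_eqF.
  rewrite mulrAC ler_pdivrMr// mul1r mass_cons.
  by rewrite (le_trans (y := d * a))// ?lerDl ?(ltW m'0)// mulrC ler_pM2r// ltW.
have td : d <= t.
  by apply: le_trans ti1; rewrite ler_peMl ?(ltW d0)// ler1n.
(* Beyond [d], the tail factor trades the normalising constant of the whole list for that of the
   remaining steps; the induction hypothesis applies at [t - d] with the index lowered by one. *)
rewrite ltNge td/= mulrA (mulrC (mass _ _ _)) divfK ?gt_eqF//.
apply: IH => //; move: ti1 ti2; rewrite -![in X in X -> _]natr1 => ti1.
by rewrite -!natr1 => ti2; apply/andP; split; lra.
Qed.

Lemma tail_concat_add h d k T : 0 <= d -> 0 <= T -> borel_density h ->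
  borel_density k -> LInt `[d + T, +oo[ (concat h d k) =
  LInt `[d, +oo[ h * LInt `[T, +oo[ k.
Proof.
move=> d0 T0 dh dk; have [_ mh] := dh; have [[k0 _ k1] mk] := dk.
have dc := borel_density_concat d0 dh dk; have [[c0 _ _] mc] := dc.
have dT : 0 <= d + T by rewrite addr_ge0.
apply: EFin_inj; rewrite EFinM (tailE dc dT) (tailE dk T0).
have /= := @integral_affine R 1 d T (EFin \o concat h d k) ltr01.
rewrite !mul1r addrC => <-; last 2 first.
- by apply/measurable_EFinP; apply: measurable_tail => //; rewrite addrC.
- by move=> x xd; rewrite lee_fin c0// (le_trans _ xd)// addrC.
rewrite mul1e -leb_integralZl; last 4 first.
- exact: measurable_itv.
- exact: measurable_tail.
- by move=> t; rewrite /= in_itv/= andbT => /(le_trans T0)/k0.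
- exact: tail_ge0.
apply: eq_integral => t; rewrite inE/= in_itv/= andbT => /(le_trans T0) t0.
by rewrite mul1r /concat ltNge lerDr t0/= addrK.
Qed.

(** The last piece is the uniform density on exactly [[0, d]], so nothing is left after it; earlier
    pieces only multiply this by their tail masses. *)
Lemma tail_step d a s : 0 < d -> 0 < a -> all (> 0) s ->
  LInt `[(size s).+1%:R * d, +oo[ (step d a s) = 0.
Proof.
move=> d0; elim: s a => [|b s IH] a a0 s0; have m0 := mass_gt0 d0 a0 s0.
  rewrite /= tail_scale ?mul1r ?(ltW d0) ?divr_gt0//; last exact: borel_density_varpi1.
  apply: tail_varpi1_eq0; rewrite /mass big_nil addr0 mulrAC.
  by rewrite ler_pdivlMr ?mulr_gt0// mul1r mulrC.
have /andP[b0 s0'] := s0.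
rewrite [size _]/= -natr1 mulrDl mul1r addrC [step _ _ _]/= tail_concat_add.
- by rewrite IH// mulr0.
- exact: ltW.
- by rewrite mulr_ge0// ltW.
- by apply: borel_density_scale; [rewrite divr_gt0|exact: borel_density_varpi1].
- exact: borel_density_step.
Qed.

(** Comparing integrals on [[0, M[], where [f] has mass at least [1 - e], shows that [mass d a s]
    differs from [1] by at most [2 * e]. Normalising thus costs [2 * e], the approximation on [[0,
    M[] costs [e], and the tail of [f] costs [e]. *)
Lemma dist_step_le f d a s (e : R) : borel_density f -> 0 < d -> 0 < a ->
  all (> 0) s -> let M := (size s).+1%:R * d in
  LInt `[M, +oo[ f <= e ->
  (\int[leb]_(t in `[0%R, M[) `|f t - mass d a s * step d a s t|%:E <= e%:E)%E ->
  (dist f (step d a s) <= (4 * e)%:E)%E.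
Proof.
move=> df d0 a0 s0 M fM fe.
have dh := borel_density_step d0 a0 s0; have m0 := mass_gt0 d0 a0 s0.
have th := tail_step d0 a0 s0.
have M0 : 0 <= M by rewrite mulr_ge0// ltW.
set h := step d a s in fe dh th *; set m := mass d a s in fe m0 *.
have [[f0 _ f1] mf] := df; have [[h0 _ h1] mh] := dh.
have sub : `[0, M[%classic `<=` @Rplus R by rewrite (Rplus_split M0); exact: subsetUl.
have mM f' : measurable_fun Rplus f' -> measurable_fun `[0, M[ f'.
  by apply: measurable_funS => //; exact: measurable_Rplus.
have mMh : measurable_fun Rplus (fun t => m * h t) by exact: measurable_funM.
have If : (\int[leb]_(t in `[0%R, M[) (f t)%:E = (1 - LInt `[M, +oo[ f)%:E)%E.
  have := f1; rewrite (integral_split M0 (borel_density_Lmeasurable df) f0).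
  by rewrite -tailE// EFinB => <-; rewrite addeK.
have Ih : (\int[leb]_(t in `[0%R, M[) (h t)%:E = 1%:E)%E.
  have := h1; rewrite (integral_split M0 (borel_density_Lmeasurable dh) h0).
  by rewrite -tailE// th adde0.
have f0' t : `[0, M[%classic t -> 0 <= f t by move=> /sub/RplusP/f0.
have h0' t : `[0, M[%classic t -> 0 <= h t by move=> /sub/RplusP/h0.
have Imh : (\int[leb]_(t in `[0%R, M[) (m * h t)%:E = m%:E)%E.
  by rewrite leb_integralZl ?Ih ?mule1// ?(ltW m0)//; exact: mM.
have mfh : measurable_fun `[0, M[ (fun t => `|f t - m * h t|).
  by apply: mM; exact: measurable_dist.
have F0 := tail_ge0 df M0.
have m1 : m <= 1 + e.
  rewrite -lee_fin -Imh.
  apply: (@le_trans _ _ (\int[leb]_(t in `[0%R, M[) (f t + `|f t - m * h t|)%:E)%E).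
    apply: leb_le_integral => //; [exact: mM|by apply: measurable_funD => //; exact: mM|].
    move=> t /[dup] /h0' ht /f0' ft; rewrite mulr_ge0 ?(ltW m0)//=.
    by rewrite -lerBlDl distrC ler_norm.
  rewrite leb_integralD//; last exact: mM.
  by rewrite If [leRHS]EFinD; apply: leeD => //; rewrite lee_fin; lra.
have m2 : 1 - 2 * e <= m.
  have : ((1 - LInt `[M, +oo[ f)%:E <= (m + e)%:E)%E.
    rewrite -If.
    apply: (@le_trans _ _ (\int[leb]_(t in `[0%R, M[) (m * h t + `|f t - m * h t|)%:E)%E).
      apply: leb_le_integral => //; [exact: mM|by apply: measurable_funD => //; exact: mM|].
      by move=> t /f0' -> /=; rewrite -lerBlDl ler_norm.
    rewrite leb_integralD//; [|exact: mM|by move=> t /h0' ht; rewrite mulr_ge0// ltW].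
    by rewrite Imh [leRHS]EFinD; apply: leeD.
  by rewrite lee_fin; lra.
have nm1 : `|m - 1| <= 2 * e by rewrite ler_norml; apply/andP; split; lra.
rewrite (dist_split M0)//.
have -> : 4 * e = (e + 2 * e) + e by ring.
rewrite [leRHS]EFinD; apply: leeD; last first.
  apply: (@le_trans _ _ (\int[leb]_(t in `[M, +oo[) (f t + h t)%:E)%E).
    apply: leb_le_integral => //.
    - by apply: measurable_tail => //; exact: measurable_dist.
    - by apply: measurable_tail => //; exact: measurable_funD.
    - move=> t; rewrite /= in_itv/= andbT => /(le_trans M0) t0; rewrite normr_ge0/=.
      by rewrite (le_trans (ler_normB _ _))// !ger0_norm ?f0 ?h0.
  rewrite leb_integralD//; try exact: measurable_tail.
  - by rewrite -!tailE// th adde0 lee_fin.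
  - by move=> t; rewrite /= in_itv/= andbT => /(le_trans M0)/f0.
  - by move=> t; rewrite /= in_itv/= andbT => /(le_trans M0)/h0.
apply: (@le_trans _ _ (\int[leb]_(t in `[0%R, M[) (`|f t - m * h t| + `|m - 1| * h t)%:E)%E).
  apply: leb_le_integral => //.
  - by apply: mM; exact: measurable_dist.
  - apply: measurable_funD => //; apply: mM; exact: measurable_funM.
  - move=> t /h0' ht; rewrite normr_ge0/= -[X in _ + _ * X](ger0_norm ht) -normrM.
    have -> : f t - h t = (f t - m * h t) + (m - 1) * h t by ring.
    exact: ler_normD.
rewrite leb_integralD//; [|by apply: mM; exact: measurable_funM|by move=> t /h0' ht; rewrite mulr_ge0].
rewrite [leRHS]EFinD; apply: leeD => //.
by rewrite leb_integralZl ?Ih ?mule1 ?lee_fin//; exact: mM.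
Qed.

End StepDensities.

(** * Approximation of Borel densities by step densities in L^1 *)

Section StepApproximation.
Set Implicit Arguments.
Unset Strict Implicit.
Context {R : realType}.
Implicit Types (f h k : R -> R) (a b c d l t T M : R) (s : seq R).

(** The property [P d t] holds for small [d] locally uniformly in [t], so compactness in its
    near-covering form gives one [d] for the whole segment. The point [u] may lie outside the
    segment. *)
Lemma unif_continuous_segment (G : R -> R) M (e : R) : continuous G -> 0 < e ->
  exists2 d, 0 < d & forall t u, 0 <= t <= M -> `|t - u| < d -> `|G t - G u| <= e.
Proof.
move=> cG e0.
have /compact_near_coveringP cpt := @segment_compact R 0 M.
pose P d t := forall u : R, `|t - u| < d -> `|G t - G u| <= e.
have : \forall d \near (0 : R)^'+, `[0, M]%classic `<=` P d.
  apply: cpt => x _; have e20 : 0 < e / 2 by rewrite divr_gt0.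
  have /cvgrPdist_le/(_ _ e20)/nbhs_ballP[r /= r0 Hr] := cG x.
  have r20 : 0 < r / 2 by rewrite divr_gt0.
  exists (ball x (r / 2), [set d | 0 < d < r / 2]).
    split => /=; first exact: nbhsx_ballx.
    by near=> d; apply/andP; split; near: d; [exact: nbhs_right_gt|exact: nbhs_right_lt].
  move=> [t d]/= [xt /andP[d0 dr]] u tu.
  have h1 : `|G x - G t| <= e / 2.
    by apply: Hr; apply: le_ball xt; lra.
  have h2 : `|G x - G u| <= e / 2.
    apply: Hr; rewrite /ball/= in xt *.
    have -> : x - u = (x - t) + (t - u) by ring.
    by apply: (le_lt_trans (ler_normD _ _)); lra.
  have -> : G t - G u = (G x - G u) - (G x - G t) by ring.
  by apply: (le_trans (ler_normB _ _)); lra.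
move=> H; have [d [d0 Hd]] := filter_ex (filterI (nbhs_right_gt (0 : R)) H).
by exists d => // t u t0M; apply: Hd; rewrite /= in_itv.
Unshelve. all: by end_near. Qed.

(** By monotone convergence, the mass on [[0, n[] tends to [1]. *)
Lemma tail_small f (e : R) : borel_density f -> 0 < e ->
  exists2 M, 0 < M & LInt `[M, +oo[ f <= e.
Proof.
move=> df e0; have [[f0 _ f1] mf] := df.
pose F (n : nat) : set R := `[0, n%:R[%classic.
have subF n : F n `<=` @Rplus R by rewrite (Rplus_split (ler0n _ n)); exact: subsetUl.
have mfF n : measurable_fun (F n) (EFin \o f).
  apply/measurable_EFinP; apply: measurable_funS mf; first exact: measurable_Rplus.
  exact: subF.
have F0 n x : F n x -> (0 <= (EFin \o f) x)%E by move=> /subF/RplusP/f0.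
have UF : \bigcup_n F n = @Rplus R.
  apply/seteqP; split; first by move=> t [n _ /subF].
  move=> t /RplusP t0; exists (Num.truncn t).+1 => //; rewrite /F/= in_itv/= t0/=.
  by have /andP[] := truncn_itv t0.
have ndF : nondecreasing_seq F.
  move=> n m nm; apply/subsetPset => t; rewrite /F/= !in_itv/= => /andP[->]/= tn.
  by apply: (lt_le_trans tn); rewrite ler_nat.
have mF n : measurable (F n) by exact: measurable_itv.
have := @ge0_nondecreasing_set_cvg_integral _ (measurableTypeR R) R F (EFin \o f)
  lebesgue_measure ndF mF mfF F0.
rewrite UF -integral_lebE; last 3 first.
- exact: measurable_Rplus.
- exact/measurable_EFinP.
- by move=> t /RplusP/f0.
rewrite f1 => /fine_cvgP[_ /cvgrPdist_le/(_ _ e0)[N _ HN]].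
exists N.+1%:R => //; have := HN N.+1 (leqnSn N).
rewrite /= -integral_lebE; last 3 first.
- exact: measurable_itv.
- exact: mfF.
- exact: F0.
have := f1; rewrite (integral_split (ler0n _ N.+1) (borel_density_Lmeasurable df) f0) /F.
rewrite -tailE//.
move: (LInt _ _) => L; move: (\int[leb]_(_ in _) _)%E => [r| |]//= [rL].
by rewrite ler_norml => /andP[_ h]; lra.
Qed.

Lemma continuous_approx f M (e : R) : borel_density f -> 0 < M -> 0 < e ->
  exists2 G : R -> R, continuous G &
    (\int[leb]_(t in `[0%R, M[) `|f t - G t|%:E <= e%:E)%E.
Proof.
move=> df M0 e0; have [[f0 _ f1] mf] := df.
have subM : `[0, M]%classic `<=` @Rplus R.
  by move=> t; rewrite /= in_itv/= => /andP[t0 _]; exact/RplusP.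
have mfM : measurable_fun `[0, M] f.
  by apply: measurable_funS mf => //; exact: measurable_Rplus.
have fi : lebesgue_measure.-integrable `[0, M] (EFin \o f).
  apply/integrableP; split; first exact/measurable_EFinP.
  under eq_integral.
    move=> t; rewrite inE => /subM/RplusP t0; rewrite /= ger0_norm ?f0//; over.
  rewrite -integral_lebE//; last 2 first.
  - exact/measurable_EFinP.
  - by move=> t /subM/RplusP/f0.
  apply: (@le_lt_trans _ _ (\int[leb]_(t in Rplus) (f t)%:E)%E); last by rewrite f1 ltry.
  apply: leb_subset_integral => //; first exact: measurable_Rplus.
  by move=> t /RplusP/f0.
have Mfin : (lebesgue_measure (`[0%R, M]%classic : set R) < +oo)%E.
  by rewrite lebesgue_measure_itv/= lte_fin M0 -EFinD ltry.
have [G [cG iG]] := approximation_continuous_integrable (measurable_itv _) Mfin fi.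
(* [N1] makes the integral finite, so that [fine] can be undone; [N2] makes it small. *)
move=> /fine_cvgP[[N1 _ HN1] /cvgrPdist_le/(_ _ e0)[N2 _ HN2]].
pose N := maxn N1 N2; exists (G N) => //.
have mfG : measurable_fun `[0, M] (fun t => `|f t - G N t|).
  apply: measurableT_comp => //; apply: measurable_funB => //.
  by apply: measurable_funTS; exact: continuous_measurable_fun.
apply: (@le_trans _ _ (\int[leb]_(t in `[0%R, M]) `|f t - G N t|%:E)%E).
  apply: leb_subset_integral => //.
  by move=> t; rewrite /= !in_itv/= => /andP[-> /ltW ->].
rewrite integral_lebE//; last exact/measurable_EFinP.
have := HN1 N (leq_maxl _ _); have := HN2 N (leq_maxr _ _) => /=.
rewrite sub0r normrN => h1 h2; rewrite -[leLHS]fineK// lee_fin.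
by apply: le_trans h1; exact: ler_norm.
Qed.

(** Truncate at [M], replace [f] by a continuous [G], and sample [G] at the left end points of a
    fine mesh. As [dist_step_le] multiplies errors by [4], the tail gets [e / 4], and so does [[0,
    M[]: [e / 8] for [G] and [2 * c * M = e / 8] for the sampling. *)
Lemma step_approx f (e : R) : borel_density f -> 0 < e ->
  exists d a s, [/\ 0 < d, 0 < a, all (> 0) s & (dist f (step d a s) <= e%:E)%E].
Proof.
move=> df e0; have e40 : 0 < e / 4 by rewrite divr_gt0.
have e80 : 0 < e / 8 by rewrite divr_gt0.
have [M M0 fM] := tail_small df e40.
have [G cG fG] := continuous_approx df M0 e80.
pose c := e / 16 / M; have c0 : 0 < c by rewrite !divr_gt0.
have [r r0 Hr] := unif_continuous_segment M cG c0.
(* [n.+1] pieces fill [[0, M[] exactly, and [n.+1 > M / r] makes the mesh finer than [r]. *)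
pose n := Num.truncn (M / r); pose d := M / n.+1%:R.
have d0 : 0 < d by rewrite divr_gt0.
have dM : n.+1%:R * d = M by rewrite /d mulrC divfK// pnatr_eq0.
have dr : d < r.
  rewrite /d ltr_pdivrMr// mulrC -ltr_pdivrMr//.
  by have /andP[] := truncn_itv (divr_ge0 (ltW M0) (ltW r0)).
(* Step values must be positive: the absolute value does not increase the distance to [f >= 0], and
   the added [c] makes the samples positive at a cost of [c]. *)
pose A (i : nat) := `|G (i%:R * d)| + c.
have A0 i : 0 < A i by rewrite /A ltr_wpDl.
pose s := [seq A i | i <- iota 1 n].
have ss : size s = n by rewrite size_map size_iota.
have s0 : all (> 0) s by apply/allP => x /mapP[i _ ->].
exists d, (A 0%N), s; split => //.
have -> : e = 4 * (e / 4) by rewrite mulrC divfK// pnatr_eq0.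
have [[f0 _ _] mf] := df; have [_ mh] := borel_density_step d0 (A0 0%N) s0.
have sub : `[0, M[%classic `<=` @Rplus R.
  by rewrite (Rplus_split (ltW M0)); exact: subsetUl.
have mM f' : measurable_fun Rplus f' -> measurable_fun `[0, M[ f'.
  by apply: measurable_funS => //; exact: measurable_Rplus.
have mG : measurable_fun Rplus G.
  by apply: measurable_funTS; exact: continuous_measurable_fun.
apply: dist_step_le => //; rewrite ss dM//.
apply: (@le_trans _ _ (\int[leb]_(t in `[0%R, M[) (`|f t - G t| + 2 * c)%:E)%E).
  apply: leb_le_integral => //.
  - by apply: mM; apply: measurable_dist => //; exact: measurable_funM.
  - by apply: measurable_funD => //; apply: mM; exact: measurable_dist.
  move=> t tM; rewrite normr_ge0/=; have /RplusP t0 := sub _ tM.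
  have tM' : t < M by move: tM; rewrite /= in_itv/= => /andP[].
  pose i := Num.truncn (t / d).
  have /andP[i1 i2] := truncn_itv (divr_ge0 t0 (ltW d0)).
  rewrite ler_pdivlMr// in i1; rewrite ltr_pdivrMr// in i2.
  rewrite -/i in i1 i2.
  have iN : (i <= n)%N.
    rewrite -ltnS -(ltr_nat R) -(ltr_pM2r d0) dM; exact: le_lt_trans tM'.
  rewrite (@step_val _ _ _ _ i)//; [|by rewrite ss|by rewrite i1].
  have -> : nth 0 (A 0%N :: s) i = A i.
    have -> : A 0%N :: s = [seq A j | j <- iota 0 n.+1] by [].
    by rewrite (nth_map 0%N) ?size_iota// nth_iota.
  have Gi : `|G t - G (i%:R * d)| <= c.
    apply: Hr; first by rewrite t0 ltW.
    by rewrite ger0_norm ?subr_ge0//; apply: lt_trans dr; move: i2; rewrite -natr1; lra.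
  rewrite /A.
  have -> : f t - (`|G (i%:R * d)| + c) =
     (`|f t| - `|G t|) + ((`|G t| - `|G (i%:R * d)|) - c) by rewrite (ger0_norm (f0 _ t0)); ring.
  apply: (le_trans (ler_normD _ _)); apply: lerD; first exact: ler_dist_dist.
  apply: (le_trans (ler_normB _ _)); rewrite (gtr0_norm c0).
  have -> : 2 * c = c + c by ring.
  by rewrite lerD2r; apply: le_trans Gi; exact: ler_dist_dist.
rewrite leb_integralD//; [|by apply: mM; exact: measurable_dist|by move=> t _; rewrite mulr_ge0// ltW].
rewrite leb_integral_cst; [|by apply: mulr_ge0 => //; exact: ltW|exact: ltW].
have -> : e / 4 = e / 8 + 2 * c * M.
  rewrite /c; field; by rewrite gt_eqF.
by rewrite [leRHS]EFinD; apply: leeD.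
Qed.

End StepApproximation.

(** * Power and exponential densities; measurability of piecewise continuous densities *)

Section PowerExponential.
Set Implicit Arguments.
Unset Strict Implicit.
Context {R : realType}.
Implicit Types (f h k : R -> R) (a b c d l t T M : R) (s : seq R).

Lemma continuous_at0_bound f (e : R) : {for 0, continuous f} -> 0 < e ->
  exists2 s, 0 < s & forall t, 0 <= t < s -> `|f t - f 0| <= e.
Proof.
move=> /cvgrPdist_le/(_ e) + e0 => /(_ e0)/nbhs_ballP[r /= r0 Hr].
exists r => // t /andP[t0 tr]; rewrite distrC; apply: Hr.
by rewrite /ball/= sub0r normrN ger0_norm.
Qed.

(** Integrating the functional equation gives the tail mass [c / l]; dividing by it turns the factor
    [c] into the [l] of the scaling. *)
Lemma shift_scale_of_eq f c l T : borel_density f -> 0 <= T -> 0 < l -> 0 < c ->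
  (forall t, 0 <= t -> f (t + T) = c * f (l * t)) ->
  forall t, 0 <= t -> rho_shift f T t = rho_scale f l t.
Proof.
move=> df T0 l0 c0 fE; have [[f0 _ f1] mf] := df.
have tE : LInt `[T, +oo[ f = c / l.
  apply: EFin_inj; rewrite tailE// -integral_shift//.
  have -> : (\int[leb]_(t in Rplus) (f (t + T)%R)%:E =
     \int[leb]_(t in Rplus) (c / l * rho_scale f l t)%:E)%E.
    apply: eq_integral => t; rewrite inE => /RplusP t0; rewrite fE// /rho_scale.
    by rewrite mulrA divfK// gt_eqF.
  have [[s0 _ s1] ms] := borel_density_scale l0 df.
  rewrite leb_integralZl//; last 3 first.
  - exact: measurable_Rplus.
  - by move=> t /RplusP/s0.
  - by rewrite divr_ge0// ltW.
  by rewrite s1 mule1.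
move=> t t0; rewrite /rho_shift tE fE// /rho_scale.
by rewrite invf_div mulrACA mulrC mulrA -mulrA; field; rewrite !gt_eqF.
Qed.

Lemma power_measurable f : power_density f -> measurable_fun Rplus f.
Proof.
move=> [_ [al [be [ga [al0 be0 ga0 fE]]]]].
apply: (@eq_measurable_fun _ _ _ _ _ (fun t => (al + be * t) `^ (- ga))).
  by move=> t; rewrite inE => /RplusP t0; rewrite fE.
apply: measurable_funTS; apply: (measurableT_comp (measurable_powR _)).
by apply: measurable_funD => //; exact: measurable_funM.
Qed.

Lemma power_borel_density f : power_density f -> borel_density f.
Proof. by move=> pf; split; [case: pf|exact: power_measurable]. Qed.

(** With [l = al / (al + be * T)], the base [al + be * (t + T)] is [(al + be * T) / al] times
    [al + be * (l * t)]; the power makes this constant a factor, which normalisation absorbs. *)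
Lemma power_shift f al be ga T : is_density f -> 0 < al -> 0 < be -> 0 < ga ->
  (forall t, 0 <= t -> f t = (al + be * t) `^ (- ga)) -> 0 < T ->
  forall t, 0 <= t -> rho_shift f T t = rho_scale f (al / (al + be * T)) t.
Proof.
move=> df al0 be0 ga0 fE T0.
have bf : borel_density f by apply: power_borel_density; split => //; exists al, be, ga.
have aT : 0 < al + be * T by rewrite addr_gt0// mulr_gt0.
apply: (@shift_scale_of_eq _ (((al + be * T) / al) `^ (- ga))) => //.
- exact: ltW.
- by rewrite divr_gt0.
- by rewrite powR_gt0// divr_gt0.
move=> t t0; rewrite !fE ?addr_ge0 ?(ltW T0)//; last first.
  by rewrite mulr_ge0// divr_ge0// ltW.
rewrite -powRM; last 2 first.
- by rewrite divr_ge0// ltW.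
- by rewrite addr_ge0 ?(ltW al0)// mulr_ge0 ?(ltW be0)// mulr_ge0// divr_ge0// ltW.
by congr (_ `^ _); field; rewrite !gt_eqF.
Qed.

Lemma self_similar_power f : power_density f -> self_similar f.
Proof.
move=> pf; have bf := power_borel_density pf.
have [df [al [be [ga [al0 be0 ga0 fE]]]]] := pf.
split => //.
- by rewrite fE// mulr0 addr0 powR_gt0.
- move=> e e0.
  have cl : {for 0, continuous (fun t : R => al + be * t)}.
    by apply: cvgD; [exact: cvg_cst|apply: cvgM; [exact: cvg_cst|exact: cvg_id]].
  (* The base is positive at nonnegative times, where the power becomes [expR] of a multiple of
     [ln]. *)
  have ce : {for 0, continuous (fun t : R => expR (- ga * ln (al + be * t)))}.
    apply: (continuous_comp (g := expR)); last exact: continuous_expR.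
    apply: cvgM; first exact: cvg_cst.
    apply: (continuous_comp (g := @ln R) cl).
    by apply: continuous_ln; rewrite mulr0 addr0.
  have [s s0 Hs] := continuous_at0_bound ce e0.
  have fexp t : 0 <= t -> f t = expR (- ga * ln (al + be * t)).
    move=> t0; rewrite fE// /powR gt_eqF//.
    by rewrite ltr_pwDl// mulr_ge0// ltW.
  by exists s => // t ts; rewrite !fexp//; [exact: Hs|case/andP: ts].
- move=> T T0 _; exists (al / (al + be * T)).
    by rewrite divr_gt0// addr_gt0// mulr_gt0.
  exact: (power_shift df al0 be0 ga0 fE T0).
Qed.

(** Witness that power densities exist, for the passage from all of them to some. The antiderivative
    [- (1 + t)^-1] gives the total mass. *)
Lemma power_density_inv2 : power_density (fun t : R => (1 + 1 * t) `^ (- 2)).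
Proof.
split; last by exists 1, 1, 2; split.
pose f t : R := ((1 + t) ^+ 2)^-1.
have fE t : 0 <= t -> (1 + 1 * t) `^ (- 2) = f t.
  by move=> t0; rewrite mul1r powRN -[2]/(2%:R) powR_mulrn// addr_ge0.
have c1 : continuous (fun t : R => 1 + t).
  by move=> t; apply: cvgD; [exact: cvg_cst|exact: cvg_id].
have cf t : 0 <= t -> {for t, continuous f}.
  move=> t0; apply: (@cvgV _ _ _ _ (fun t : R => (1 + t) ^+ 2)).
    by rewrite expf_neq0// gt_eqF// ltr_pwDl.
  exact: (cvgM (c1 t) (c1 t)).
have cfw : {within `[0, +oo[, continuous f}.
  apply: continuous_in_subspaceT => t; rewrite inE/= in_itv/= andbT; exact: cf.
have mf : measurable_fun Rplus f.
  by apply: subspace_continuous_measurable_fun => //; exact: measurable_Rplus.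
have f0 t : 0 <= f t by rewrite /f invr_ge0 sqr_ge0.
pose F t : R := - (1 + t)^-1.
have dF (x : R) : 0 < x -> is_derive x (1 : R) F (f x).
  move=> x0; have x10 : 1 + x != 0 by rewrite gt_eqF// addr_gt0.
  have d1 : is_derive x (1 : R) (fun t : R => 1 + t) 1.
    have := is_deriveD (is_derive_cst (1 : R) x 1) (is_derive_id x (1 : R)).
    by rewrite add0r.
  have dV := @is_deriveV _ (fun t : R => 1 + t) x 1 1 x10 d1.
  apply: (is_derive_eq (is_deriveN dV)).
  by rewrite /f scaleNr opprK [_ *: _]mulr1.
have I1 : (\int[leb]_(t in Rplus) (f t)%:E = 1)%E.
  rewrite integral_lebE; last 3 first.
  - exact: measurable_Rplus.
  - exact/measurable_EFinP.
  - by move=> t _; rewrite lee_fin.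
  rewrite (@ge0_continuous_FTC2y _ f F 0 0)//.
  - by rewrite /F addr0 invr1 EFinN oppeK add0e.
  - rewrite -oppr0; apply: cvgN; apply/gtr0_cvgV0.
      by near=> t; rewrite addr_gt0//; near: t; apply: nbhs_pinfty_gt; exact: num_real.
    apply/cvgryPge => A; near=> t.
    suff : A <= t by lra.
    by near: t; apply: nbhs_pinfty_ge; exact: num_real.
  - by move=> x x0; have [] := dF x x0.
  - apply: cvg_at_right_filter; apply: cvgN; apply: cvgV; last exact: c1.
    by rewrite addr0 oner_neq0.
  - by move=> x; rewrite in_itv/= andbT => /dF Fx; rewrite derive1E; exact: derive_val.
suff [] : borel_density (fun t : R => (1 + 1 * t) `^ (- 2)) by [].
apply: borel_densityP.
- apply: (@eq_measurable_fun _ _ _ _ _ f) => // t.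
  by rewrite inE => /RplusP t0; rewrite fE.
- by move=> t t0; rewrite powR_ge0.
- rewrite -I1; apply: eq_integral => t; rewrite inE => /RplusP t0.
  by rewrite fE.
Unshelve. all: by end_near. Qed.

Lemma continuous_pi_exp1 : continuous (@pi_exp R 1).
Proof.
move=> t; apply: cvgM; first exact: cvg_cst.
apply: (@continuous_comp _ _ _ (fun x : R => - (1 * x)) expR); last exact: continuous_expR.
apply: cvgN; apply: cvgM; [exact: cvg_cst|exact: cvg_id].
Qed.

Lemma borel_density_pi_exp1 : borel_density (@pi_exp R 1).
Proof.
have mp : measurable_fun Rplus (@pi_exp R 1).
  by apply: measurable_funTS; apply: continuous_measurable_fun; exact: continuous_pi_exp1.
have p0 t : 0 <= t -> 0 <= @pi_exp R 1 t by move=> _; rewrite /pi_exp mul1r expR_ge0.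
apply: borel_densityP => //.
rewrite integral_lebE; last 3 first.
- exact: measurable_Rplus.
- exact/measurable_EFinP.
- by move=> t /RplusP/p0.
rewrite -(integral_exponential_pdf ltr01) [in LHS]integral_mkcond.
apply: eq_integral => t _; rewrite /exponential_pdf restrict_EFin.
rewrite /pi_exp; congr (_%:E); congr (patch _ _ _ _); apply/funext => x /=.
by rewrite mulNr.
Qed.

Lemma self_similar_pi_exp1 : self_similar (@pi_exp R 1).
Proof.
have bp := borel_density_pi_exp1; split => //.
- by rewrite /pi_exp mul1r expR_gt0.
- move=> e; apply: continuous_at0_bound.
  exact: continuous_pi_exp1.
(* The exponential density is memoryless: its shifts are the density itself. *)
- move=> T T0 _; exists 1 => //; apply: (@shift_scale_of_eq _ (expR (- T))) => //.
  + exact: ltW.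
  + exact: expR_gt0.
  + by move=> t t0; rewrite /pi_exp !mul1r -expRD opprD addrC.
Qed.

(** Discontinuities may accumulate at [0], but each [[1 / n.+1, n.+1]] holds finitely many, so they
    form a countable set, all of whose subsets are Borel; off this set [f] is continuous. *)
Lemma piecewise_continuous_measurable f : piecewise_continuous f ->
  measurable_fun Rplus f.
Proof.
(* [N] contains [0] too, since piecewise continuity concerns positive points only. *)
move=> [ff _]; pose N := [set x : R | 0 <= x /\ (0 < x -> ~ {for x, continuous f})].
have cN : countable N.
  pose B (n : nat) := [set 0] `|`
    [set x | (n.+1%:R : R)^-1 <= x <= n.+1%:R /\ ~ {for x, continuous f}].
  apply: (@sub_countable _ _ _ (\bigcup_n B n)); last first.
    apply: bigcup_countable => // n _; apply: finite_set_countable.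
    by rewrite finite_setU; split; [exact: finite_set1|apply: ff; rewrite invr_gt0].
  apply: subset_card_le => x [x0 xN].
  have [->|xn0] := eqVneq x 0; first by exists 0%N => //; left.
  have {}x0 : 0 < x by rewrite lt_neqAle eq_sym xn0.
  have xV0 : 0 < x^-1 by rewrite invr_gt0.
  (* The successor of this index bounds both [x] and [x^-1]. *)
  exists (Num.truncn x + Num.truncn x^-1)%N => //; right; split; last exact: xN.
  have /andP[_ h1] := truncn_itv (ltW x0); have /andP[_ h2] := truncn_itv (ltW xV0).
  apply/andP; split.
    rewrite -[leRHS]invrK lef_pV2 ?posrE//; apply: (le_trans (ltW h2)).
    by rewrite ler_nat ltnS leq_addl.
  by apply: (le_trans (ltW h1)); rewrite ler_nat ltnS leq_addr.
have mN (A : set R) : A `<=` N -> measurable A.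
  move=> AN; apply: countable_measurable => //.
  by apply: sub_countable cN; exact: subset_card_le.
have -> : @Rplus R = (Rplus `\` N) `|` N.
  by rewrite setUC setDUK// => x [x0 _]; exact/RplusP.
have mD : measurable (@Rplus R `\` N).
  by apply: measurableD; [exact: measurable_Rplus|exact: mN].
apply/measurable_funU => //; first exact: mN.
split; last by move=> _ Y mY; apply: mN; exact: subIsetl.
apply: subspace_continuous_measurable_fun => //.
apply: continuous_in_subspaceT => x; rewrite inE => -[/RplusP x0 xN].
by apply: contrapT => nc; apply: xN; split.
Qed.

(** The only positive discontinuity is [1]. Through this lemma, the limits for all piecewise
    continuous densities include the one along [varpi]. *)
Lemma piecewise_continuous_varpi1 : piecewise_continuous (@varpi R 1).
Proof.
have lt1 (x : R) : 0 < x < 1 -> \forall y \near x, varpi 1 y = 1 :> R.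
  move=> /andP[x0 x1]; near=> y.
  have y0 : 0 < y by near: y; exact: lt_nbhsr.
  have y1 : y < 1 by near: y; exact: lt_nbhsl.
  by rewrite varpi1E ?(ltW y0)// (ltW y1).
have gt1 (x : R) : 1 < x -> \forall y \near x, varpi 1 y = 0 :> R.
  move=> x1; near=> y.
  have y1 : 1 < y by near: y; exact: lt_nbhsr.
  by rewrite varpi1E; [rewrite leNgt y1|exact: ltW (lt_trans ltr01 y1)].
have cv (x : R) : 0 < x -> x != 1 -> {for x, continuous (varpi 1)}.
  move=> x0 x1; have [xl|xg|xe] := ltgtP x 1.
  - have xx : \forall y \near x, varpi 1 y = 1 :> R by apply: lt1; rewrite x0.
    by apply: cvg_near_cst; rewrite (nbhs_singleton xx).
  - have xx := gt1 x xg.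
    by apply: cvg_near_cst; rewrite (nbhs_singleton xx).
  - by rewrite xe eqxx in x1.
split.
  move=> a b a0; apply: (@sub_finite_set _ _ [set 1]); last exact: finite_set1.
  move=> x [/andP[ax _] nc]; apply: contrapT => /eqP x1; apply: nc.
  by apply: cv => //; exact: lt_le_trans ax.
move=> x x0; have [->|x1] := eqVneq x 1; last first.
  have c := cv x x0 x1; split; apply: cvgP.
    exact: (cvg_at_left_filter c).
  exact: (cvg_at_right_filter c).
have cl : varpi 1 y @[y --> (1 : R)^'-] --> (1 : R).
  apply: cvg_near_cst; near=> y.
  have y0 : 0 < y by near: y; exact: nbhs_left_gt.
  have y1 : y < 1 by near: y; exact: nbhs_left_lt.
  by rewrite varpi1E ?(ltW y0)// (ltW y1).
have cr : varpi 1 y @[y --> (1 : R)^'+] --> (0 : R).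
  apply: cvg_near_cst; near=> y.
  have y1 : 1 < y by near: y; exact: nbhs_right_gt.
  by rewrite varpi1E; [rewrite leNgt y1|exact: ltW (lt_trans ltr01 y1)].
by split; [exact: cvgP cl|exact: cvgP cr].
Unshelve. all: by end_near. Qed.

End PowerExponential.

(** * Costs and values as Lipschitz functions of the density *)

Section Game.
Set Implicit Arguments.
Unset Strict Implicit.
Context {R : realType} {Omega : Type} {K : set (R -> Omega)}.
Context {g : Omega -> R} {V : ((R -> Omega) -> R) -> Omega -> R}.
Context (U : Omega -> R).
Context (g01 : forall w, 0 <= g w <= 1).
Context (mg : forall z, K z -> Lmeasurable_on Rplus (fun t : R => g (z t))).
Context (gmV : game_mapping K V) (dpp : satisfies_dpp g V).
Implicit Types (f h k : R -> R) (z : R -> Omega) (w : Omega).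

Local Notation VV rho := (V (cost g rho)).

Lemma LInt_norm_le (D : set R) (F H : R -> R) (e : R) : measurable D ->
  measurable_fun (D : set LR) (F : LR -> R) ->
  measurable_fun (D : set LR) (H : LR -> R) ->
  (forall t, D t -> `|F t| <= H t) ->
  (\int[leb]_(t in D) (H t)%:E <= e%:E)%E -> `|LInt D F| <= e.
Proof.
move=> mD mF mH FH He; have mDL := borel_Lmeasurable mD.
have : (`|\int[leb]_(t in D) (F t)%:E| <= e%:E)%E.
  apply: le_trans He; have mFE := proj2 (measurable_EFinP _ _) mF.
  apply: (le_trans (le_abse_integral leb mDL mFE)).
  apply: ge0_le_integral.
  - exact: mDL.
  - by move=> t _.
  - by apply: measurableT_comp => //.
  - exact: (proj2 (measurable_EFinP _ _) mH).
  - by move=> t Dt; rewrite lee_fin FH.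
by rewrite /LInt; case: (\int[leb]_(_ in _) _)%E => [r| |].
Qed.

Lemma measurable_cost f z : is_density f -> K z ->
  measurable_fun (Rplus : set LR) ((fun t => f t * g (z t)) : LR -> R).
Proof.
move=> [_ fi _] Kz; apply: measurable_funM; last exact: mg.
by apply/measurable_EFinP; exact: measurable_int fi.
Qed.

Lemma cost_norm_le f z t : 0 <= t -> is_density f -> `|f t * g (z t)| <= f t.
Proof.
move=> t0 [f0 _ _]; have /andP[h0 h1] := g01 (z t).
by rewrite normrM !ger0_norm// ?f0// ler_piMr// f0.
Qed.

Lemma density_Lmeasurable f : is_density f ->
  measurable_fun (Rplus : set LR) (f : LR -> R).
Proof. by move=> [_ fi _]; apply/measurable_EFinP; exact: measurable_int fi. Qed.

Lemma cost_bounded f : is_density f -> bounded_on K (cost g f).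
Proof.
move=> df; exists 1 => z Kz; apply: (@LInt_norm_le Rplus _ f).
- exact: measurable_Rplus.
- exact: measurable_cost.
- exact: density_Lmeasurable.
- by move=> t; rewrite /Rplus/= in_itv/= andbT => t0; exact: cost_norm_le.
- by case: df => _ _ ->.
Qed.

Lemma integrable_cost f z : is_density f -> K z ->
  leb.-integrable Rplus (EFin \o (fun t => f t * g (z t))).
Proof.
move=> df Kz; have [f0 fi _] := df.
apply: le_integrable fi.
- by apply: borel_Lmeasurable; exact: measurable_Rplus.
- by apply/measurable_EFinP; exact: measurable_cost.
- move=> t; rewrite /Rplus/= in_itv/= andbT => t0.
  by rewrite lee_fin (le_trans (cost_norm_le _ t0 df))// ler_norm.
Qed.

(** As [g] takes values in [[0, 1]], the integrands differ by at most [|f t - h t|] on every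
    trajectory. *)
Lemma cost_lip f h z (e : R) : is_density f -> is_density h -> K z ->
  (dist f h <= e%:E)%E -> `|cost g f z - cost g h z| <= e.
Proof.
move=> df dh Kz fhe.
have mRL : measurable (Rplus : set (@LR R)).
  by apply: borel_Lmeasurable; exact: measurable_Rplus.
have fi := integrable_cost df Kz; have hi := integrable_cost dh Kz.
have -> : cost g f z - cost g h z = LInt Rplus (fun t => f t * g (z t) - h t * g (z t)).
  rewrite /LInt; under eq_integral do rewrite EFinD EFinN.
  rewrite (integralB_EFin mRL fi hi) fineB//; exact: integrable_fin_num.
apply: (@LInt_norm_le _ _ (fun t => `|f t - h t|)).
- exact: measurable_Rplus.
- by apply: measurable_funB; exact: measurable_cost.
- have mfh := measurable_funB (density_Lmeasurable df) (density_Lmeasurable dh).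
  exact: (measurableT_comp (@normr_measurable R setT) mfh).
- move=> t _; rewrite -mulrBl normrM; have /andP[h0 h1] := g01 (z t).
  by rewrite (ger0_norm h0) ler_piMr.
- exact: fhe.
Qed.

(** From [c1 <= c2 + e] on [K], monotonicity and compatibility with constants give
    [V c1 <= V c2 + e]; exchanging the costs gives the other bound. *)
Lemma game_mapping_lip c1 c2 (e : R) w : bounded_on K c1 -> bounded_on K c2 ->
  (forall z, K z -> `|c1 z - c2 z| <= e) -> `|V c1 w - V c2 w| <= e.
Proof.
move=> b1 b2; have [_ VA Vm] := gmV.
suff H c c' : bounded_on K c -> bounded_on K c' ->
    (forall z, K z -> `|c z - c' z| <= e) -> V c w <= V c' w + e.
  move=> c12; have := H _ _ b1 b2 c12; have := H _ _ b2 b1.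
  move=> /(_ _)/wrap[z Kz|]; first by rewrite distrC c12.
  by move=> h1 h2; rewrite ler_norml; apply/andP; split; lra.
move=> bc bc' cc'.
have := VA c' 1 e bc' ler01 => /(congr1 (@^~ w)); rewrite mul1r => <-.
apply: Vm => //.
  case: bc' => M cM; exists (M + `|e|) => z Kz; rewrite mul1r.
  by apply: (le_trans (ler_normD _ _)); rewrite lerD2r cM.
by move=> z Kz; have := cc' z Kz; rewrite ler_norml mul1r => /andP[_]; lra.
Qed.

Lemma value_lip f h (e : R) w : is_density f -> is_density h ->
  (dist f h <= e%:E)%E -> `|VV f w - VV h w| <= e.
Proof.
move=> df dh fh; apply: game_mapping_lip; try exact: cost_bounded.
by move=> z Kz; exact: cost_lip.
Qed.

Lemma cost_ext f h : (forall t, 0 <= t -> f t = h t) -> cost g f = cost g h.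
Proof.
move=> fh; apply/funext => z; rewrite /cost /LInt; congr fine.
by apply: eq_integral => t; rewrite inE/= in_itv/= andbT => t0; rewrite fh.
Qed.

(** * Good densities: closure under L^1 limits and concatenation *)

Definition good f := unif_to_0 (fun l => VV (rho_scale f l)) U.

Lemma good_ext f h : (forall t, 0 <= t -> f t = h t) -> good f -> good h.
Proof.
move=> fh Gf e e0; have [d [d0 H]] := Gf e e0; exists d; split => // x xd w.
rewrite -(@cost_ext (rho_scale f x)); first exact: H.
move=> t t0; rewrite /rho_scale fh// mulr_ge0//.
by case/andP: xd => /ltW.
Qed.

Lemma good_scale f (a : R) : 0 < a -> good f -> good (rho_scale f a).
Proof.
move=> a0 Gf e e0; have [d [d0 H]] := Gf e e0.
exists (d / a); split; first by rewrite divr_gt0.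
move=> x /andP[x0 xd] w.
have -> : rho_scale (rho_scale f a) x = rho_scale f (x * a).
  by apply/funext => t; rewrite /rho_scale -mulrA; congr (_ * (_ * f _)); ring.
by apply: H; rewrite mulr_gt0//= -ltr_pdivlMr.
Qed.

(** Since scaling preserves [dist], an approximating [h] stays within [e / 2] of [f] at every scale,
    so the threshold of [h] serves for [f]. *)
Lemma good_L1_closed f : borel_density f ->
  (forall e : R, 0 < e -> exists h, [/\ borel_density h, good h & (dist f h <= e%:E)%E]) ->
  good f.
Proof.
move=> df H e e0; have [|h [dh Gh fh]] := H (e / 2); first by rewrite divr_gt0.
have [|d [d0 Hd]] := Gh (e / 2); first by rewrite divr_gt0.
exists d; split => // x xd w; have x0 : 0 < x by case/andP: xd.
have h1 : `|VV (rho_scale f x) w - VV (rho_scale h x) w| <= e / 2.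
  apply: value_lip.
  - by case: (borel_density_scale x0 df).
  - by case: (borel_density_scale x0 dh).
  - by case: df dh => [_ mf] [_ mh]; rewrite dist_scale.
have h2 := Hd x xd w.
have -> : VV (rho_scale f x) w - U w = (VV (rho_scale f x) w - VV (rho_scale h x) w)
   + (VV (rho_scale h x) w - U w) by ring.
by rewrite (le_trans (ler_normD _ _))// (le_trans (lerD h1 h2))//; lra.
Qed.

(** The axioms of a game mapping speak of bounded costs only, so [game_mapping_lip] needs this
    before it applies to [dpp_cost]. *)
Lemma dpp_bounded f (T : R) : borel_density f -> 0 < T -> 0 < LInt `[T, +oo[ f ->
  bounded_on K (dpp_cost g V f T).
Proof.
move=> df T0 FT; have dF := borel_density_shift (ltW T0) FT df.
have [Vb _ _] := gmV; have [M VM] := Vb _ (cost_bounded (proj1 dF)).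
exists (1 + `|LInt `[T, +oo[ f| * M) => z Kz; rewrite /dpp_cost.
apply: (le_trans (ler_normD _ _)); rewrite lerD//; last first.
  by rewrite normrM ler_wpM2l// VM.
have sT : `[0, T[%classic `<=` @Rplus R.
  by rewrite (Rplus_split (ltW T0)); exact: subsetUl.
have mRL := borel_Lmeasurable (@measurable_Rplus R).
have [[f0 _ f1] mf] := df.
apply: (@LInt_norm_le _ _ f).
- exact: measurable_itv.
- by apply: measurable_funS (measurable_cost (proj1 df) Kz).
- by apply: measurable_funS (density_Lmeasurable (proj1 df)).
- by move=> t /= /sT; rewrite /Rplus/= in_itv/= andbT => t0; apply: cost_norm_le; case: df.
- rewrite -f1; apply: leb_subset_integral => //; first exact: measurable_Rplus.
  by move=> t; rewrite /Rplus/= in_itv/= andbT; exact: f0.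
Qed.

(** Scaled by [x], the densities [concat h d k] and [h] coincide up to [d / x]. The dynamic
    programming costs at that time differ only through the values of the scaled [k] and of the
    scaled shift of [h] at the state [z (d / x)]; by uniformity on [Omega] both are close to [U]
    there. So the value of the concatenation follows that of [h]. *)
Lemma good_concat h d k : 0 < d -> borel_density h -> borel_density k ->
  0 < LInt `[d, +oo[ h ->
  good h -> good (rho_shift h d) -> good k -> good (concat h d k).
Proof.
move=> d0 dh dk F0 Gh Ghd Gk e e0.
have e3 : 0 < e / 3 by rewrite divr_gt0.
have dc := borel_density_concat (ltW d0) dh dk.
have [d1 [d10 H1]] := Gh _ e3; have [d2 [d20 H2]] := Ghd _ e3.
have [d3 [d30 H3]] := Gk _ e3.
exists (Num.min d1 (Num.min d2 d3)); split; first by rewrite !lt_min d10 d20.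
move=> x /andP[x0]; rewrite !lt_min => /and3P[xd1 xd2 xd3] w.
have dx0 : 0 < d / x by rewrite divr_gt0.
have xdx : x * (d / x) = d by rewrite mulrC divfK// gt_eqF.
have dcx := borel_density_scale x0 dc; have dhx := borel_density_scale x0 dh.
have tc : LInt `[d / x, +oo[ (rho_scale (concat h d k) x) = LInt `[d, +oo[ h.
  by rewrite tail_scale ?ltW// xdx tail_concat ?ltW.
have th : LInt `[d / x, +oo[ (rho_scale h x) = LInt `[d, +oo[ h.
  by rewrite tail_scale ?ltW// xdx.
(* Scaling by [x] and then shifting by [d / x] amounts to shifting by [d] and then scaling by
   [x]. *)
have shift_scale f : LInt `[d / x, +oo[ (rho_scale f x) = LInt `[d, +oo[ f ->
    rho_shift (rho_scale f x) (d / x) = rho_scale (rho_shift f d) x.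
  move=> E; apply/funext => t; rewrite /rho_shift /rho_scale E.
  by rewrite mulrDr xdx mulrA.
have sc : cost g (rho_shift (rho_scale (concat h d k) x) (d / x)) = cost g (rho_scale k x).
  rewrite shift_scale; last by rewrite tc tail_concat ?ltW.
  apply: cost_ext => t t0; rewrite /rho_scale shift_concat ?(ltW d0)//.
  by rewrite mulr_ge0// ltW.
have main : `|VV (rho_scale (concat h d k) x) w - VV (rho_scale h x) w| <= 2 * (e / 3).
  rewrite -!(dpp (T := d / x)) ?tc ?th//; [|by case: dhx|by case: dcx].
  apply: game_mapping_lip; [by apply: dpp_bounded => //; rewrite tc|by apply: dpp_bounded => //; rewrite th|].
  move=> z Kz; rewrite /dpp_cost tc th sc shift_scale//.
  have -> : LInt `[0, d / x[ (fun t => rho_scale (concat h d k) x t * g (z t)) =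
            LInt `[0, d / x[ (fun t => rho_scale h x t * g (z t)).
    rewrite /LInt; congr fine; apply: eq_integral => t.
    rewrite inE/= in_itv/= ltr_pdivlMr// => /andP[_ td].
    by rewrite /rho_scale /concat (mulrC x t) td.
  (* The common initial costs cancel; the tail mass is at most [1], and the two remaining values are
     each within [e / 3] of [U (z (d / x))]. *)
  rewrite opprD addrACA subrr add0r -mulrBr normrM (gtr0_norm F0).
  rewrite -[leRHS]mul1r; apply: ler_pM => //; [exact: ltW|exact: tail_le1 (ltW d0)|].
  have h2 := H2 x; have h3 := H3 x.
  rewrite x0 xd2 in h2; rewrite x0 xd3 in h3.
  have {h2} := h2 isT (z (d / x)); have {h3} := h3 isT (z (d / x)).
  rewrite !ler_norml => /andP[a1 a2] /andP[a3 a4]; apply/andP; split; lra.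
have h1 := H1 x; rewrite x0 xd1 in h1; have {h1} := h1 isT w.
move: main; rewrite !ler_norml => /andP[a1 a2] /andP[a3 a4]; apply/andP; split; lra.
Qed.

(** The shift of [rho_scale f a] by [d] is the scaling by [a] of the shift of [f] by [a * d], itself
    a scaling of [f]; so its goodness comes from that of [f]. *)
Lemma good_concat_similar f (a d : R) k : self_similar f -> good f -> 0 < a ->
  0 < d -> 0 < LInt `[a * d, +oo[ f -> borel_density k -> good k ->
  good (concat (rho_scale f a) d k).
Proof.
move=> [df _ _ fs] Gf a0 d0 F0 dk Gk.
have tF : LInt `[d, +oo[ (rho_scale f a) = LInt `[a * d, +oo[ f.
  by rewrite tail_scale// ltW.
have ad0 : 0 < a * d by rewrite mulr_gt0.
have [l l0 fl] := fs _ ad0 F0.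
apply: good_concat => //.
- exact: borel_density_scale.
- by rewrite tF.
- exact: good_scale.
- apply: (good_ext _ (good_scale a0 (good_scale l0 Gf))) => t t0.
  rewrite {1}/rho_scale -fl ?mulr_ge0// ?(ltW a0)//.
  by rewrite /rho_shift tF /rho_scale mulrDr mulrA.
Qed.

Lemma good_varpi1 f : self_similar f -> good f -> good (varpi 1).
Proof.
move=> sf Gf; have [df _ _ _] := sf; have dv := @borel_density_varpi1 R.
apply: good_L1_closed => // e e0.
have e20 : 0 < e / 2 by rewrite divr_gt0.
have [s [s0 q0 q1 Hs]] := self_similar_flat sf e20.
set q := LInt `[s, +oo[ f in q0 q1 Hs; set l := s / (1 - q) in Hs.
have p0 : 0 < 1 - q by rewrite subr_gt0.
have l0 : 0 < l by rewrite divr_gt0.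
have qV0 : 0 < q^-1 by rewrite invr_gt0.
have lp : l * (1 - q) = s by rewrite /l divfK// gt_eqF.
(* Each stage puts a nearly flat piece of length [1 - q] in front of the previous density compressed
   by the factor [q], so the pieces of [kk n] end at the points [1 - q ^ i]. *)
pose kk := fix kk n := if n is n'.+1
  then concat (rho_scale f l) (1 - q) (rho_scale (kk n') q^-1) else f.
have dkk n : borel_density (kk n).
  elim: n => //= n IH; apply: borel_density_concat; first exact: ltW.
    exact: borel_density_scale.
  exact: borel_density_scale.
have Gkk n : good (kk n).
  elim: n => //= n IH; apply: good_concat_similar => //.
  - by rewrite lp.
  - exact: borel_density_scale.
  - exact: good_scale.
have dfl : borel_density (rho_scale f l) by exact: borel_density_scale.
have tv : LInt `[1 - q, +oo[ (@varpi R 1) = q.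
  by rewrite tail_varpi1; [ring|rewrite ltW//=; lra].
have tf : LInt `[1 - q, +oo[ (rho_scale f l) = q.
  by rewrite tail_scale ?(ltW p0)// lp.
(* [varpi 1] is a fixed point of the same construction with an exactly flat first piece. *)
have vE : dist (varpi 1) =1 dist (concat (varpi 1) (1 - q) (rho_scale (varpi 1) q^-1)).
  move=> h; apply: eq_integral => t; rewrite inE => /RplusP t0.
  congr (`|_ - _|%:E); rewrite /concat; case: ltP => // qt.
  rewrite tv /rho_scale mulrA divff ?gt_eqF// mul1r.
  have qt' : 0 <= t - (1 - q) by rewrite subr_ge0.
  rewrite !varpi1E//; last by rewrite mulr_ge0// ltW.
  by rewrite mulrC ler_pdivrMr// mul1r; congr (if _ then _ else _); apply/idP/idP; lra.
(* By [dist_concat] the distance [D n] satisfies [D (n + 1) <= (1 - q) * (e / 2) + q * D n],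
   starting from [D 0 <= 2]. *)
have kv n : (dist (kk n) (varpi 1) <= (e / 2 + 2 * q ^+ n)%:E)%E.
  elim: n => [|n IH].
    by apply: (le_trans (dist_le2 df dv)); rewrite lee_fin expr0; lra.
  rewrite dist_sym vE dist_sym /= dist_concat//; last 4 first.
  - exact: ltW.
  - exact: borel_density_scale.
  - exact: borel_density_scale.
  - by rewrite tf tv.
  rewrite dist_scale//; [|by case: (dkk n)|by case: dv].
  rewrite tf; have -> : e / 2 + 2 * q ^+ n.+1 =
      e / 2 * (1 - q) + q * (e / 2 + 2 * q ^+ n) by rewrite exprS; ring.
  rewrite EFinD; apply: leeD; last first.
    by rewrite EFinM; apply: lee_wpmul2l => //; rewrite lee_fin ltW.
  rewrite -leb_integral_cst; [|exact: ltW|exact: ltW].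
  have sub : `[0, 1 - q[%classic `<=` @Rplus R.
    by rewrite (Rplus_split (ltW p0)); exact: subsetUl.
  apply: leb_le_integral => //.
    apply: (@measurable_funS _ _ _ _ (@Rplus R)) => //; first exact: measurable_Rplus.
    by apply: measurable_dist; [case: dfl|case: dv].
  move=> t; rewrite /= in_itv/= => /andP[t0 tq]; rewrite normr_ge0/=.
  by rewrite varpi1E// ifT; [apply: Hs; rewrite t0|lra].
have [n qn] : exists n, 2 * q ^+ n <= e / 2.
  have /cvgrPdist_le : (fun n => q ^+ n) @ \oo --> (0 : R).
    by apply: cvg_expr; rewrite gtr0_norm.
  have e40 : 0 < e / 4 by rewrite divr_gt0.
  move=> /(_ _ e40) [N _ HN]; exists N.
  have := HN N (leqnn N); rewrite /= sub0r normrN ger0_norm; last by rewrite exprn_ge0// ltW.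
  lra.
exists (kk n); split => //; rewrite dist_sym; apply: (le_trans (kv n)).
by rewrite lee_fin; lra.
Qed.

(** As [varpi 1] is itself self-similar, every concatenation in [step] falls under
    [good_concat_similar]. *)
Lemma good_step d a s : 0 < d -> 0 < a -> all (> 0) s -> good (varpi 1) ->
  good (step d a s).
Proof.
move=> d0 + + Gv; elim: s a => [|b s IH] a a0 s0; have m0 := mass_gt0 d0 a0 s0.
  by apply: good_scale => //; rewrite divr_gt0.
have /andP[b0 s0'] := s0; have m'0 := mass_gt0 d0 b0 s0'.
have am0 := divr_gt0 a0 m0.
apply: good_concat_similar => //.
- exact: self_similar_varpi1.
- rewrite -tail_scale ?(ltW d0)//; last exact: borel_density_varpi1.
  by rewrite tail_scale_varpi1// divr_gt0.
- exact: borel_density_step.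
- exact: IH.
Qed.

Lemma good_borel_density f : good (varpi 1) -> borel_density f -> good f.
Proof.
move=> Gv df; apply: good_L1_closed => // e e0.
have [d [a [s [d0 a0 s0 fs]]]] := step_approx df e0.
by exists (step d a s); split => //; [exact: borel_density_step|exact: good_step].
Qed.

Lemma good_self_similar f h : self_similar f -> good f -> borel_density h -> good h.
Proof. by move=> sf Gf; apply: good_borel_density; exact: good_varpi1 Gf. Qed.

(** * The three model limits expressed as goodness of one density *)

Lemma good_varpi1P : good (varpi 1) <-> unif_to_oo (fun T => VV (varpi T)) U.
Proof.
have scaleE (T : R) : 0 < T -> rho_scale (varpi 1) T^-1 = varpi T.
  move=> T0; apply/funext => t; rewrite /rho_scale /varpi.
  rewrite pmulr_rge0 ?invr_gt0// mulrC [_ * t]mulrC ler_pdivrMr// mul1r invr1.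
  by case: ifP; rewrite ?mul1r ?mul0r.
split=> H e e0.
  have [d [d0 Hd]] := H e e0; exists d^-1 => T dT w.
  have T0 : 0 < T by apply: lt_trans dT; rewrite invr_gt0.
  by rewrite -scaleE//; apply: Hd; rewrite invr_gt0 T0/= invf_plt.
(* The maximum with [1] is positive even when [M] is not, so its inverse is a valid threshold. *)
have [M HM] := H e e0; exists (Num.max M 1)^-1; split.
  by rewrite invr_gt0 lt_max ltr01 orbT.
move=> x /andP[x0 xM] w; rewrite -[x]invrK scaleE ?invr_gt0//.
apply: HM; apply: (@le_lt_trans _ _ (Num.max M 1)); first by rewrite le_max lexx.
by rewrite invf_pgt ?posrE// lt_max ltr01 orbT.
Qed.

Lemma good_pi_exp1P : good (pi_exp 1) <-> unif_to_0 (fun l => VV (pi_exp l)) U.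
Proof.
have scaleE l : rho_scale (pi_exp 1) l = pi_exp l.
  by apply/funext => t; rewrite /rho_scale /pi_exp !mul1r.
have E : (fun l => VV (rho_scale (pi_exp 1) l)) = (fun l => VV (pi_exp l)).
  by apply/funext => l; rewrite scaleE.
by rewrite /good E.
Qed.

(** The shift by [T] is the scaling by [al / (al + be * T)], which decreases to [0] as [T] grows, so
    the two limits run over the same scales. *)
Lemma good_powerP f : power_density f ->
  good f <-> unif_to_oo (fun T => VV (rho_shift f T)) U.
Proof.
move=> pf; have [df [al [be [ga [al0 be0 ga0 fE]]]]] := pf.
have shiftE T : 0 < T -> cost g (rho_shift f T) = cost g (rho_scale f (al / (al + be * T))).
  by move=> T0; apply: cost_ext => t t0; rewrite (power_shift df al0 be0 ga0 fE T0).
split=> H e e0.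
  have [d [d0 Hd]] := H e e0; exists (al / (be * d)) => T dT w.
  have T0 : 0 < T by apply: lt_trans dT; rewrite divr_gt0// mulr_gt0.
  have aT : 0 < al + be * T by rewrite addr_gt0// mulr_gt0.
  rewrite shiftE//; apply: Hd; rewrite divr_gt0//= ltr_pdivrMr//.
  by rewrite ltr_pdivrMr ?mulr_gt0// in dT; have := mulr_gt0 d0 al0; lra.
have [M HM] := H e e0; pose M' := Num.max M 1.
have M'0 : 0 < M' by rewrite lt_max ltr01 orbT.
have aM : 0 < al + be * M' by rewrite addr_gt0// mulr_gt0.
exists (al / (al + be * M')); split; first by rewrite divr_gt0.
move=> x /andP[x0 xM] w.
(* The solution of [x = al / (al + be * T)]: every small scale is reached by a shift. *)
pose T := (al / x - al) / be.
have xT : x = al / (al + be * T).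
  have -> : al + be * T = al / x by rewrite /T; field; rewrite !gt_eqF.
  by rewrite invf_div mulrC divfK// gt_eqF.
have MT : M' < T.
  rewrite ltr_pdivlMr// in xM.
  by rewrite /T ltr_pdivlMr// ltrBrDl ltr_pdivlMr//; nra.
rewrite {1}xT -shiftE; last exact: lt_trans MT.
by apply: HM; apply: le_lt_trans MT; rewrite le_max lexx.
Qed.

End Game.

(** * Equivalence of the five conditions and the common limit *)

Theorem theorem1 (R : realType) (Omega : Type) (K : set (R -> Omega))
  (g : Omega -> R) (V : ((R -> Omega) -> R) -> Omega -> R) (Ustar : Omega -> R) :
  (exists w : Omega, True) -> K !=set0 ->
  (forall w, 0 <= g w <= 1) ->
  (forall z, K z -> Lmeasurable_on Rplus (fun t : R => g (z t))) ->
  game_mapping K V -> satisfies_dpp g V ->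
  (forall w, 0 <= Ustar w <= 1) ->
  let VV := fun rho : R -> R => V (cost g rho) in
  let Pc := forall mu, is_density mu -> piecewise_continuous mu ->
              unif_to_0 (fun l => VV (rho_scale mu l)) Ustar in
  let Pu := unif_to_oo (fun T => VV (varpi T)) Ustar in
  let Pe := unif_to_0 (fun l => VV (pi_exp l)) Ustar in
  let Pp := exists rho, power_density rho /\
              unif_to_oo (fun T => VV (rho_shift rho T)) Ustar in
  let Pq := forall rho, power_density rho ->
              unif_to_oo (fun T => VV (rho_shift rho T)) Ustar in
  ((Pc <-> Pu) /\ (Pu <-> Pe) /\ (Pe <-> Pp) /\ (Pp <-> Pq)) /\
  (forall mu rho, is_density mu -> piecewise_continuous mu -> power_density rho ->
   forall U : Omega -> R,
     unif_to_oo (fun T => VV (varpi T)) U \/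
     unif_to_0 (fun l => VV (pi_exp l)) U \/
     unif_to_oo (fun T => VV (rho_shift rho T)) U ->
     [/\ unif_to_oo (fun T => VV (varpi T)) U,
         unif_to_0 (fun l => VV (pi_exp l)) U,
         unif_to_oo (fun T => VV (rho_shift rho T)) U,
         unif_to_0 (fun l => VV (rho_scale mu l)) U &
         forall mu' rho', is_density mu' -> piecewise_continuous mu' ->
           power_density rho' ->
           unif_to_oo (fun T => VV (rho_shift rho' T)) U /\
           unif_to_0 (fun l => VV (rho_scale mu' l)) U]).

Proof.
move=> _ _ g01 mg gmV dpp _ VV Pc Pu Pe Pp Pq.
have vP U := good_varpi1P (g := g) (V := V) U.
have eP U : unif_to_0 (fun l => V (cost g (pi_exp l))) U -> @good R Omega g V U (pi_exp 1).
  exact: (iffRL (good_pi_exp1P U)).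
have Pe_ U : @good R Omega g V U (pi_exp 1) -> unif_to_0 (fun l => V (cost g (pi_exp l))) U.
  exact: (iffLR (good_pi_exp1P U)).
have pP U f := @good_powerP R Omega g V U f.
(* Goodness spreads from one self-similar density to all Borel densities; this is applied in turn to
   [varpi 1], [pi_exp 1] and the power densities. *)
have ss U f h : self_similar f -> @good R Omega g V U f -> borel_density h -> @good R Omega g V U h.
  exact: (good_self_similar g01 mg gmV dpp).
have pc_bd f : is_density f -> piecewise_continuous f -> borel_density f.
  by move=> df pf; split => //; exact: piecewise_continuous_measurable.
have sv := @self_similar_varpi1 R; have se := @self_similar_pi_exp1 R.
have bv := @borel_density_varpi1 R; have be := @borel_density_pi_exp1 R.
have sp f := @self_similar_power R f; have bp f := @power_borel_density R f.
have cu : Pc <-> Pu.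
  split=> [H|/vP H mu dmu pmu].
    by apply/vP; apply: H; [case: bv|exact: piecewise_continuous_varpi1].
  by apply: (ss _ _ _ sv H); exact: pc_bd.
have ue : Pu <-> Pe.
  by split=> [/vP H|/eP H]; [apply: Pe_; exact: (ss _ _ _ sv)|apply/vP; exact: (ss _ _ _ se)].
have eq : Pe -> Pq.
  by move=> /eP H f pf; apply/(pP _ _ pf); apply: (ss _ _ _ se H); exact: bp.
have qp : Pq -> Pp.
  move=> H; have pf := @power_density_inv2 R.
  by exists (fun t : R => (1 + 1 * t) `^ (- 2)); split => //; exact: H.
have pe : Pp -> Pe.
  move=> [f [pf /(pP _ _ pf) H]]; apply: Pe_; apply: (ss _ _ _ (sp _ pf) H) => //.
split; first by split => //; split => //; split; split => //; [move/eq/qp|move/pe/eq].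
move=> mu rho dmu pmu prho U H.
(* Whichever limit is given, it makes [varpi 1] good for [U], and then every Borel density is good
   for the same [U]. *)
have Gv : @good R Omega g V U (varpi 1).
  case: H => [/vP//|[/eP H|/(pP _ _ prho) H]]; first exact: (ss _ _ _ se H).
  exact: (ss _ _ _ (sp _ prho) H).
have G f : borel_density f -> @good R Omega g V U f by exact: (ss _ _ _ sv Gv).
split.
- exact/vP.
- by apply: Pe_; exact: G.
- by apply/(pP _ _ prho); apply: G; exact: bp.
- by apply: G; exact: pc_bd.
- move=> mu' rho' dmu' pmu' prho'; split; first by apply/(pP _ _ prho'); apply: G; exact: bp.
  by apply: G; exact: pc_bd.
Qed.
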